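(* Fix $n$ and $\tau\in\mathcal A_n$. Suppose that for each dimension $d$, $Z_1,\ldots,Z_\tau\stackrel{iid}{\sim}F_1$ and, independently, $Z_{\tau+1},\ldots,Z_n\stackrel{iid}{\sim}F_2$, where $F_1=F_{1,d}$, $F_2=F_{2,d}$ are distributions on $\mathbb{R}^d$ with mean vectors $\mu_{1},\mu_{2}$ and covariance matrices $\Sigma_{1},\Sigma_{2}$ satisfying: (A1) the coordinate variables in $F_1$ and $F_2$ have uniformly bounded fourth moments; (A2) for all $r,s\in\{1,2\}$, if $Z\sim F_r$ and $Z_*\sim F_s$ are independent and $W=Z-Z_*$, then $\sum_{q\neq q'}\big|\mathrm{Corr}\big((W^{(q)})^2,(W^{(q')})^2\big)\big|=o(d^2)$ as $d\to\infty$; (A3) as $d\to\infty$, $\frac1d\|\mu_1-\mu_2\|^2\to\nu^2$ and $\frac1d\mathrm{trace}(\Sigma_i)\to\sigma_i^2$ for $i=1,2$, with finite limits. Suppose $\nu^2>0$ or $\sigma_1^2\ne\sigma_2^2$. Then: (a) $\mathbb{P}(\widehat T_n=\tau)\to1$ as $d\to\infty$. (b) Let $\alpha\in(0,1)$. If $|\mathcal B(\rho_{n,\tau})|/n!\le\alpha$, then the change-point $\tau$ is detected (by $\widehat T_n$) at level $\alpha$ with probability converging to one, i.e. $\mathbb{P}(\widehat T_n=\tau,\ \widehat S_n>\widehat c_{1-\alpha})\to1$ as $d\to\infty$.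
   Context: $\|\cdot\|$ is the Euclidean norm; $W^{(q)}$ denotes the $q$-th coordinate. For $2\le t\le n-2$ define $$T_{11}(t)=\binom t2^{-1}\sum_{1\le i<j\le t}\|Z_i-Z_j\|,\quad T_{22}(t)=\binom{n-t}2^{-1}\sum_{t+1\le i<j\le n}\|Z_i-Z_j\|,\quad T_{12}(t)=\frac1{t(n-t)}\sum_{i=1}^{t}\sum_{j=t+1}^{n}\|Z_i-Z_j\|,$$ $\mathcal D_n(t)=\{T_{12}(t)-T_{11}(t)\}^2+\{T_{12}(t)-T_{22}(t)\}^2$, and $w(t)=t(n-t)/n^2$. With $\delta_n\in(0,1/2)$ and $m=\lfloor n\delta_n\rfloor$ (usual floor, $m\ge2$ so that everything is defined), $\mathcal A_n=\{m,m+1,\ldots,n-m\}$. Define $\widehat S_n=\max_{t\in\mathcal A_n}w(t)\mathcal D_n(t)$ and $\widehat T_n\in\operatorname{argmax}_{t\in\mathcal A_n}w(t)\mathcal D_n(t)$. Permutation test: for a permutation $\pi$ of $\{1,\ldots,n\}$ let $\widehat S_n^{(\pi)}$ be $\widehat S_n$ computed from $Z_{\pi(1)},\ldots,Z_{\pi(n)}$, and $\widehat c_{1-\alpha}=\inf\{x\ge 0:\frac1{n!}\sum_\pi \mathbf 1[\widehat S_n^{(\pi)}\le x]\ge1-\alpha\}$. The potential change-point $\widehat T_n$ is a detected change-point at level $\alpha$ if $\widehat S_n>\widehat c_{1-\alpha}$. Unbalanced permutations: for a permutation $\pi$ and $t\in\mathcal A_n$ let $k_\pi(t)=\#\{i\le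 t:\pi(i)\le\tau\}$, $p_\pi(t)=k_\pi(t)/t$, $q_\pi(t)=(\tau-k_\pi(t))/(n-t)$. Define $$\rho_{n,\tau}=-2\frac{w(m)}{m-1}+\sqrt{4\Big(\frac{w(m)}{m-1}\Big)^2+2\Big\{w(\tau)-\frac{w(m)}{2(m-1)^2}\Big\}},$$ $\mathcal B(\rho_{n,\tau})=\{\pi:\max_{t\in\mathcal A_n}|p_\pi(t)-q_\pi(t)|>\rho_{n,\tau}\}$. *)

(* Defs.v *)
From HB Require Import structures.
From mathcomp Require Import all_boot all_order all_algebra all_fingroup.
From mathcomp Require Import all_classical all_reals all_analysis.
Set Implicit Arguments.
Unset Strict Implicit.
Unset Printing Implicit Defensive.
Import Order.TTheory GRing.Theory Num.Theory.
Import numFieldNormedType.Exports.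
Local Open Scope classical_set_scope.
Local Open Scope ring_scope.

(** Vectors of R^d are [d.-tuple R]: the library equips this type with the
    sigma-algebra generated by the coordinates, i.e. the Borel sets of R^d. *)

Definition vsub (R : realType) (d : nat) (x y : d.-tuple R) : d.-tuple R :=
  [tuple tnth x q - tnth y q | q < d].

Definition enorm (R : realType) (d : nat) (x : d.-tuple R) : R :=
  Num.sqrt (\sum_(q < d) tnth x q ^+ 2).

(** A sample Z_1, ..., Z_n is [z : 'I_n -> d.-tuple R]. Ordinals start at 0, so
    Z_i is [z] at the ordinal of value i - 1, and "i <= t" becomes [i < t]. The
    split times t and the change point tau remain counts of observations, in
    {1, ..., n}. *)

Section Statistics.
Context (R : realType) (n d : nat).
Implicit Types (z : 'I_n -> d.-tuple R) (t m : nat).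

Definition T11 z t : R :=
  ('C(t, 2)%:R)^-1 *
  \sum_(i < n) \sum_(j < n | (i < j < t)%N) enorm (vsub (z i) (z j)).

Definition T22 z t : R :=
  ('C(n - t, 2)%:R)^-1 *
  \sum_(i < n) \sum_(j < n | (t <= i < j)%N) enorm (vsub (z i) (z j)).

Definition T12 z t : R :=
  (t * (n - t))%:R^-1 *
  \sum_(i < n | (i < t)%N) \sum_(j < n | (t <= j)%N) enorm (vsub (z i) (z j)).

Definition Dstat z t : R :=
  (T12 z t - T11 z t) ^+ 2 + (T12 z t - T22 z t) ^+ 2.

End Statistics.

Definition weight (R : realType) (n t : nat) : R :=
  (t * (n - t))%:R / n%:R ^+ 2.
Arguments weight : clear implicits.

Definition window (R : realType) (n : nat) (delta : R) : nat :=
  Num.truncn (n%:R * delta).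

Definition Aset (n m : nat) : pred nat := [pred t | (m <= t <= n - m)%N].

Section ScanAndPermutationTest.
Context (R : realType) (n d m : nat).
Implicit Types (z : 'I_n -> d.-tuple R) (t : nat) (alpha : R) (s : 'S_n).

Definition scan z t : R := weight R n t * Dstat z t.

(** The scan values are nonnegative, so the unit 0 of the iterated maximum does
    not affect its value on the nonempty range {m, ..., n - m}. *)
Definition Shat z : R := \big[Num.max/0]_(m <= t < (n - m).+1) scan z t.

Definition is_argmax z t : Prop :=
  t \in Aset n m /\ forall t', t' \in Aset n m -> scan z t' <= scan z t.

Definition perm_cdf z (x : R) : R :=
  (n`!)%:R^-1 * \sum_(s : 'S_n) (Shat (fun i => z (s i)) <= x)%R%:R.

Definition chat z alpha : R :=
  inf [set x : R | 0 <= x /\ 1 - alpha <= perm_cdf z x].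

End ScanAndPermutationTest.

Section UnbalancedPermutations.
Context (R : realType) (n m tau : nat).
Implicit Types (s : 'S_n) (t : nat).

Definition kperm s t : nat :=
  #|[pred i : 'I_n | (i < t)%N && (s i < tau)%N]|.

Definition pperm s t : R := (kperm s t)%:R / t%:R.

Definition qperm s t : R := (tau%:R - (kperm s t)%:R) / (n - t)%:R.

Definition rho : R :=
  let w := weight R n in
  - 2 * (w m / (m%:R - 1)) +
  Num.sqrt (4 * (w m / (m%:R - 1)) ^+ 2 +
            2 * (w tau - w m / (2 * (m%:R - 1) ^+ 2))).

Definition unbalanced (r : R) : {set 'S_n} :=
  [set s : 'S_n |
    r < \big[Num.max/0]_(m <= t < (n - m).+1) `|pperm s t - qperm s t| ]%SET.

End UnbalancedPermutations.
Arguments rho : clear implicits.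
Arguments unbalanced {R} n m tau r.

Section Probability.
Local Open Scope ereal_scope.

Definition mutually_independent (dO dV : measure_display)
    (Omega : measurableType dO) (V : measurableType dV) (R : realType)
    (P : probability Omega R) (I : finType) (X : I -> {RV P >-> V}) : Prop :=
  forall (J : {set I}) (B : I -> set V), (forall i, measurable (B i)) ->
    P (\bigcap_(i in [set` J]) (X i @^-1` B i)) =
    \prod_(i in J) P (X i @^-1` B i).

(** The value is 0 when one of the two variables is degenerate. *)
Definition corr (dO : measure_display) (Omega : measurableType dO)
    (R : realType) (P : probability Omega R) (X Y : Omega -> R) : R :=
  (fine (covariance P X Y) / Num.sqrt (fine 'V_P[X] * fine 'V_P[Y]))%R.

End Probability.

Section Assumptions.
Context (R : realType).
Implicit Types (F G : forall d, probability (d.-tuple R) R).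

Definition component (d : nat) (q : 'I_d) (x : d.-tuple R) : R := tnth x q.

Definition mean_vector F d : d.-tuple R :=
  [tuple fine 'E_(F d)[component q] | q < d].

Definition covariance_matrix F d : 'M[R]_d :=
  \matrix_(q < d, q' < d) fine (covariance (F d) (component q) (component q')).

Definition bounded_fourth_moments F (C : R) : Prop :=
  forall (d : nat) (q : 'I_d),
    ('E_(F d)[(fun x => component q x ^+ 4)%R] <= C%:E)%E.

Definition sqdiff_component (d : nat) (q : 'I_d) (x : d.-tuple R * d.-tuple R) : R :=
  component q (vsub x.1 x.2) ^+ 2.

(** A pair of independent variables Z ~ F_d, Z_* ~ G_d is realised as the two
    projections on R^d x R^d under the product law. *)
Definition weakly_correlated F G : Prop :=
  (fun d : nat => \sum_(q < d) \sum_(q' < d | q != q')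
     `|corr (F d \x G d)%E (sqdiff_component q) (sqdiff_component q')|)
  =o_\oo (fun d : nat => d%:R ^+ 2 : R).

End Assumptions.

(* Main.v *)
Require Import Defs.
From HB Require Import structures.
From mathcomp Require Import all_boot all_order all_algebra all_fingroup.
From mathcomp Require Import all_classical all_reals all_analysis.
From mathcomp Require Import measurable_realfun.
From mathcomp Require Import ring lra zify.
Import Order.TTheory GRing.Theory Num.Theory.
Import numFieldNormedType.Exports.
Set Implicit Arguments.
Unset Strict Implicit.
Local Open Scope classical_set_scope.
Local Open Scope ring_scope.

(** After division by the square root of d, the distances between observations
    converge in probability to deterministic limits: a inside the first group,
    b inside the second and c across, where a^2 = 2 sigma1^2, b^2 = 2 sigma2^2
    and c^2 = sigma1^2 + sigma2^2 + nu^2. Indeed the squared distance is a sum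
    of d weakly correlated squares with bounded second moments, so
    Chebyshev's inequality applies. Separation of the two laws amounts to
    a + b < 2 c.

    For the limiting distances, the two differences T12 - T11 and T12 - T22 of a
    permuted sample depend only on the proportions p and q of the first group
    before and after t. Without permutation the scan is strictly maximal at tau;
    for a permutation with |p - q| <= rho it stays strictly below that maximum,
    rho being the positive root of the quadratic equation that makes the
    resulting bound equal to w(tau). Strict inequalities between finitely many
    continuous functions of the distances survive small perturbations, so both
    conclusions hold as soon as all distances are close to their limits. *)

(** * The differences T12 - T11 and T12 - T22 in the limit *)

(** [T12 - T11] for limiting distances, with [u = c - b], [v = c - a], proportions
    [p] before and [q] after the split, and [e = 1 / (t - 1)]. [T12 - T22] is the
    same expression with [p] and [q] exchanged and [e = 1 / (n - t - 1)]. *)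
Definition gap {R : realFieldType} (u v p q e : R) : R :=
  (q - p) * (u - p * (u + v)) - p * (1 - p) * (u + v) * e.

(** Exchanging the two groups; this reduces splits after the change point to
    splits before it. *)
Lemma gap_swap (R : realFieldType) (u v p q e : R) :
  gap v u (1 - p) (1 - q) e = gap u v p q e.
Proof. by rewrite /gap; ring. Qed.

Lemma sqr_convex (R : realFieldType) (p x y : R) : 0 <= p <= 1 ->
  (p * x + (1 - p) * y) ^+ 2 <= p * x ^+ 2 + (1 - p) * y ^+ 2.
Proof.
move=> /andP[p0 p1]; rewrite -subr_ge0.
have -> : p * x ^+ 2 + (1 - p) * y ^+ 2 - (p * x + (1 - p) * y) ^+ 2 =
  p * (1 - p) * (x - y) ^+ 2 by ring.
by apply: mulr_ge0; [apply: mulr_ge0; lra|apply: sqr_ge0].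
Qed.

(** Before the change point the left part is pure ([p = 1]), so its correction term vanishes and
    both gaps carry the factor [(N - T) / (N - t)]. Convexity of the square bounds the rest by
    [(1 + th) (u^2 + v^2)], which leaves a polynomial inequality whose defect has the factor
    [T - t]. *)
Lemma early_split_lt (R : realFieldType) (u v t T N e : R) :
  1 <= t -> t + 1 <= T -> T + 2 <= N -> 0 < u ^+ 2 + v ^+ 2 ->
  t * (N - t) * (gap u v 1 ((T - t) / (N - t)) e ^+ 2 +
                 gap u v ((T - t) / (N - t)) 1 (N - t - 1)^-1 ^+ 2) <
  T * (N - T) * (u ^+ 2 + v ^+ 2).
Proof.
move=> t1 tT TN S0; set q := (T - t) / (N - t).
have Nt : N - t != 0 by lra.
have Nt1 : N - t - 1 != 0 by lra.
(* The finite-sample correction turns the proportion [q] into [th]: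
   [q (1 + 1 / (N - t - 1)) = th]. *)
pose th := (T - t) / (N - t - 1).
have th01 : 0 <= th <= 1.
  by rewrite /th divr_ge0 /= ?ler_pdivrMr; lra.
have -> : gap u v 1 q e = (N - T) / (N - t) * v.
  by rewrite /gap /q; field.
have -> : gap u v q 1 (N - t - 1)^-1 =
    (N - T) / (N - t) * ((1 - th) * u + (1 - (1 - th)) * - v).
  by rewrite /gap /q /th; field; rewrite Nt Nt1.
rewrite (exprMn _ _ v) (exprMn _ _ (_ + _)) -mulrDr mulrA.
have -> : t * (N - t) * ((N - T) / (N - t)) ^+ 2 = (N - T) * (t * (N - T) / (N - t)).
  by field.
rewrite [T * _]mulrC -!mulrA ltr_pM2l; last lra.
have th01' : 0 <= 1 - th <= 1 by case/andP: th01 => ? ?; apply/andP; split; lra.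
have := @sqr_convex R (1 - th) u (- v) th01'.
rewrite sqrrN => hc.
have hb : v ^+ 2 + ((1 - th) * u + (1 - (1 - th)) * - v) ^+ 2 <=
    (1 + th) * (u ^+ 2 + v ^+ 2).
  have := sqr_ge0 u; have := sqr_ge0 v; case/andP: th01 => th0 th1; nra.
have r0 : 0 < t * (N - T) / (N - t) by rewrite divr_gt0 ?mulr_gt0; lra.
rewrite !mulrA; apply: (le_lt_trans (ler_wpM2l (ltW r0) hb)).
rewrite mulrA ltr_pM2r //.
have -> : t * (N - T) / (N - t) * (1 + th) =
    (t * (N - T) * (N - t - 1 + (T - t))) / ((N - t) * (N - t - 1)).
  by rewrite /th; field; rewrite Nt Nt1.
rewrite ltr_pdivrMr; last by rewrite mulr_gt0; lra.
have E : T * ((N - t) * (N - t - 1)) - t * (N - T) * (N - t - 1 + (T - t)) =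
  (T - t) * (N * (N - t - 1) - t * (N - T)) by ring.
rewrite -subr_gt0 E mulr_gt0 //; first lra.
nra.
Qed.

(** Time reversal: in the reversed sample, with the groups exchanged, the split [N - t] precedes the
    change point [N - T]. *)
Lemma late_split_lt (R : realFieldType) (u v t T N e : R) :
  2 <= T -> T + 1 <= t -> t + 1 <= N -> 0 < u ^+ 2 + v ^+ 2 ->
  t * (N - t) * (gap u v (T / t) 0 (t - 1)^-1 ^+ 2 + gap u v 0 (T / t) e ^+ 2) <
  T * (N - T) * (u ^+ 2 + v ^+ 2).
Proof.
move=> T2 Tt tN S0; set p := T / t.
have t0 : t != 0 by lra.
have pE : 1 - p = (t - T) / t by rewrite /p; field.
have h := @early_split_lt R v u (N - t) (N - T) N e.
rewrite -gap_swap -[gap u v 0 _ _]gap_swap subr0 pE.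
rewrite (addrC (u ^+ 2)) (addrC (gap _ _ _ 1 _ ^+ 2)) (mulrC t) (mulrC T).
have E1 : N - (N - t) = t by ring.
have E2 : N - (N - T) = T by ring.
have E3 : N - T - (N - t) = t - T by ring.
by move: h; rewrite /= E1 E2 E3; apply; lra.
Qed.

Lemma sum_sqr_gt0 (R : realFieldType) (u v : R) : 0 < u + v -> 0 < u ^+ 2 + v ^+ 2.
Proof. by move=> D0; have := sqr_ge0 (u - v); have := mulr_gt0 D0 D0; nra. Qed.

(** Up to sign the gap is [(p - q) al + g (u + v) e], where [al] is a convex combination of [u] and
    [- v], and [g = p (1 - p)] is at most 1/4. Expanding the square with [al^2 <= S],
    [(u + v)^2 <= 2 S] and hence [|al| (u + v) <= 3/2 S] yields the three coefficients. *)
Lemma sqr_gap_le (R : realFieldType) (u v p q e r : R) :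
  0 <= p <= 1 -> `|p - q| <= r -> 0 <= e -> 0 < u + v ->
  gap u v p q e ^+ 2 <=
  (r ^+ 2 + 3 / 4 * r * e + e ^+ 2 / 8) * (u ^+ 2 + v ^+ 2).
Proof.
move=> p01 pqr e0 D0; set S := u ^+ 2 + v ^+ 2.
have [p0 p1] := andP p01.
pose al := p * - v + (1 - p) * u; pose g := p * (1 - p).
have g0 : 0 <= g by rewrite /g; nra.
have g4 : g <= 1 / 4 by rewrite /g; have := sqr_ge0 (p - 1 / 2); nra.
have r0 : 0 <= r by apply: le_trans pqr.
have S0 : 0 <= S by rewrite addr_ge0 ?sqr_ge0.
have alS : `|al| ^+ 2 <= S.
  rewrite real_normK ?num_real //; apply: le_trans (sqr_convex _ _ p01) _.
  rewrite sqrrN /S; have := sqr_ge0 u; have := sqr_ge0 v; nra.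
have DS : (u + v) ^+ 2 <= 2 * S by rewrite /S; have := sqr_ge0 (u - v); nra.
have aD : `|al| * (u + v) <= 3 / 2 * S by have := sqr_ge0 (`|al| - (u + v)); nra.
have -> : gap u v p q e ^+ 2 = (- (q - p) * al + g * (u + v) * e) ^+ 2.
  by rewrite /gap /al /g; ring.
rewrite opprB -[leLHS]real_normK ?num_real //.
have b0 : 0 <= g * (u + v) * e by do 2 (apply: mulr_ge0 => //); apply: ltW.
have hb : `|(p - q) * al + g * (u + v) * e| <= r * `|al| + g * (u + v) * e.
  apply: le_trans (ler_normD _ _) _; rewrite (ger0_norm b0) lerD2r normrM.
  by rewrite ler_wpM2r.
apply: le_trans (_ : (r * `|al| + g * (u + v) * e) ^+ 2 <= _).
  by rewrite ler_sqr ?nnegrE ?normr_ge0 // addr_ge0 // mulr_ge0 // normr_ge0.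
rewrite sqrrD !mulrDl; apply: lerD; first apply: lerD.
- by rewrite exprMn ler_wpM2l ?sqr_ge0.
- have -> : r * `|al| * (g * (u + v) * e) *+ 2 = (r * e) * (2 * g * (`|al| * (u + v))).
    by ring.
  rewrite [leRHS](_ : _ = (r * e) * (2 * (1 / 4) * (3 / 2 * S))); last by field.
  apply: ler_wpM2l; first exact: mulr_ge0.
  apply: ler_pM => //; first by rewrite mulr_ge0.
    by rewrite mulr_ge0 // ltW.
  by rewrite ler_wpM2l.
- have -> : (g * (u + v) * e) ^+ 2 = e ^+ 2 * (g ^+ 2 * (u + v) ^+ 2) by ring.
  rewrite [leRHS](_ : _ = e ^+ 2 * ((1 / 4) ^+ 2 * (2 * S))); last by field.
  apply: ler_wpM2l; first exact: sqr_ge0.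
  by apply: ler_pM; rewrite ?sqr_ge0 // ler_sqr ?nnegrE //; lra.
Qed.

(** The two bounds from [sqr_gap_le] and [w <= 1/4] give the coefficient
    [r^2 / 2 + 3/2 r x + y / 4]. It is rounded up to the quadratic behind [rho], and [y > 0] makes
    the inequality strict. *)
Lemma balanced_split_lt (R : realFieldType) (u v p q e e' w r x y : R) :
  0 <= p <= 1 -> 0 <= q <= 1 -> `|p - q| <= r -> 0 <= e -> 0 <= e' ->
  0 <= w <= 1 / 4 -> w * e <= x -> w * e' <= x ->
  w * e ^+ 2 <= y -> w * e' ^+ 2 <= y -> 0 <= x -> 0 < y -> 0 < u + v ->
  w * (gap u v p q e ^+ 2 + gap u v q p e' ^+ 2) <
  (r ^+ 2 / 2 + 2 * r * x + y / 2) * (u ^+ 2 + v ^+ 2).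
Proof.
move=> p01 q01 pqr e0 e'0 /andP[w0 w4] ex e'x ey e'y x0 y0 D0.
have S0 := sum_sqr_gt0 D0.
have r0 : 0 <= r by apply: le_trans pqr.
have h1 := sqr_gap_le p01 pqr e0 D0.
have qpr : `|q - p| <= r by rewrite distrC.
have h2 := sqr_gap_le q01 qpr e'0 D0.
apply: (le_lt_trans (ler_wpM2l w0 (lerD h1 h2))).
rewrite -mulrDl mulrA ltr_pM2r //.
have : 0 <= r * (x - w * e) by rewrite mulr_ge0 // subr_ge0.
have : 0 <= r * (x - w * e') by rewrite mulr_ge0 // subr_ge0.
have : 0 <= (1 / 4 - w) * r ^+ 2 by rewrite mulr_ge0 ?sqr_ge0 // subr_ge0.
have : 0 <= r * x by rewrite mulr_ge0.
nra.
Qed.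

(** * Scans of a two-block distance matrix *)

Definition pairs_within (R : realType) (n : nat) (A : pred 'I_n) (D : 'I_n -> 'I_n -> R) : R :=
  \sum_(i | A i) \sum_(j | A j && (i < j)%N) D i j.

Definition pairs_across (R : realType) (n : nat) (A B : pred 'I_n) (D : 'I_n -> 'I_n -> R) : R :=
  \sum_(i | A i) \sum_(j | B j) D i j.

Definition split_gap (R : realType) (n : nat) (D : 'I_n -> 'I_n -> R) (t : nat) : R :=
  let T12 := (t * (n - t))%:R^-1 *
    pairs_across (fun i : 'I_n => (i < t)%N) (fun j : 'I_n => (t <= j)%N) D in
  (T12 - ('C(t, 2)%:R)^-1 * pairs_within (fun i : 'I_n => (i < t)%N) D) ^+ 2 +
  (T12 - ('C(n - t, 2)%:R)^-1 * pairs_within (fun i : 'I_n => (t <= i)%N) D) ^+ 2.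

Lemma Dstat_split_gap (R : realType) (n d : nat) (z : 'I_n -> d.-tuple R) t :
  Dstat z t = split_gap (fun i j => enorm (vsub (z i) (z j))) t.
Proof.
rewrite /Dstat /split_gap; congr ((_ - _) ^+ 2 + (_ - _) ^+ 2).
- rewrite /T11 /pairs_within; congr (_ * _).
  rewrite [RHS]big_mkcond /=; apply: eq_bigr => i _.
  case: ifPn => it; first by apply: eq_bigl => j; rewrite andbC.
  rewrite big_pred0 // => j; apply/negbTE; lia.
- rewrite /T22 /pairs_within; congr (_ * _).
  rewrite [RHS]big_mkcond /=; apply: eq_bigr => i _.
  case: ifPn => it; first by apply: eq_bigl => j; lia.
  rewrite big_pred0 // => j; apply/negbTE; lia.
Qed.

(** The full square splits into its diagonal and two mirror triangles; this transfers product
    formulas for rectangles to sums over pairs [i < j]. *)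
Lemma across_diag (R : realType) (n : nat) (A : pred 'I_n) (D : 'I_n -> 'I_n -> R) :
  (forall i j, D i j = D j i) ->
  pairs_across A A D = \sum_(i | A i) D i i + 2 * pairs_within A D.
Proof.
move=> Ds.
have -> : pairs_across A A D = \sum_(i | A i) (D i i +
    (\sum_(j | A j && (i < j)%N) D i j + \sum_(j | A j && (j < i)%N) D i j)).
  apply: eq_bigr => i Ai; rewrite (bigD1 i) //=; congr (_ + _).
  rewrite (bigID (fun j : 'I_n => (i < j)%N)) /=.
  congr (_ + _); apply: eq_bigl => j; rewrite -val_eqE /=; case: (A j) => //=; lia.
rewrite !big_split /= mulr2n mulrDl mul1r; congr (_ + (_ + _)).
rewrite /pairs_within (exchange_big_dep A) /=; last by move=> i j _ /andP[].
apply: eq_bigr => i Ai; under eq_bigl => j do rewrite Ai /=.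
by apply: eq_bigr => j _; rewrite Ds.
Qed.

(** Agrees off the diagonal with a two-block distance matrix when [x] is the
    indicator of the first block, but is bilinear in [x] on the whole square. *)
Definition two_block (R : realType) (n : nat) (x : 'I_n -> R) (a b c : R) (i j : 'I_n) : R :=
  x i * x j * a + (1 - x i) * (1 - x j) * b + (x i * (1 - x j) + (1 - x i) * x j) * c.

Lemma across_two_block (R : realType) (n : nat) (A B : pred 'I_n) (x : 'I_n -> R) a b c :
  let X := \sum_(i | A i) x i in let X' := \sum_(i | B i) x i in
  let Y := \sum_(i | A i) (1 - x i) in let Y' := \sum_(i | B i) (1 - x i) in
  pairs_across A B (two_block x a b c) = X * X' * a + Y * Y' * b + (X * Y' + Y * X') * c.
Proof.
move=> X X' Y Y'.
have E i : \sum_(j | B j) two_block x a b c i j =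
    x i * (X' * a + Y' * c) + (1 - x i) * (Y' * b + X' * c).
  rewrite /X' /Y' !mulr_suml -!big_split /= !mulr_sumr -big_split /=.
  by apply: eq_bigr => j _; rewrite /two_block; ring.
by rewrite /pairs_across (eq_bigr _ (fun i _ => E i)) big_split /= -!mulr_suml /X /Y; ring.
Qed.

(** Idempotence makes [x] an indicator, so the diagonal of [two_block] contributes [X a + Y b];
    removing it from the full square turns [X^2] into [X (X - 1)], and likewise for [Y]. *)
Lemma within_two_block (R : realType) (n : nat) (A : pred 'I_n) (x : 'I_n -> R) a b c :
  (forall i, x i * x i = x i) ->
  let X := \sum_(i | A i) x i in let Y := \sum_(i | A i) (1 - x i) in
  2 * pairs_within A (two_block x a b c) = X * (X - 1) * a + Y * (Y - 1) * b + 2 * X * Y * c.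
Proof.
move=> xx X Y.
have Ds i j : two_block x a b c i j = two_block x a b c j i by rewrite /two_block; ring.
have -> : 2 * pairs_within A (two_block x a b c) =
    pairs_across A A (two_block x a b c) - \sum_(i | A i) two_block x a b c i i.
  by rewrite (across_diag A Ds) [RHS]addrC addKr.
rewrite across_two_block -/X -/Y.
have -> : \sum_(i | A i) two_block x a b c i i = X * a + Y * b.
  rewrite /X /Y !mulr_suml -big_split /=; apply: eq_bigr => i _.
  rewrite /two_block; have := xx i => xi.
  have -> : (1 - x i) * (1 - x i) = 1 - x i by rewrite mulrBl mul1r mulrBr mulr1 xi subrr subr0.
  have x0 : x i * (1 - x i) = 0 by rewrite mulrBr mulr1 xi subrr.
  by rewrite [(1 - x i) * x i]mulrC x0 xi; ring.
ring.
Qed.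

Lemma eq_within (R : realType) (n : nat) (A : pred 'I_n) (D D' : 'I_n -> 'I_n -> R) :
  (forall i j, i != j -> D i j = D' i j) -> pairs_within A D = pairs_within A D'.
Proof.
move=> DD; apply: eq_bigr => i _; apply: eq_bigr => j /andP[_ ij].
by apply: DD; rewrite -val_eqE /= neq_ltn ij.
Qed.

(** The diagonal is 0 like that of a genuine distance matrix, so closeness has to be checked only
    off the diagonal. *)
Definition block_dist (R : realType) (n tau : nat) (a b c : R) (i j : 'I_n) : R :=
  if i == j then 0 else
  if (i < tau)%N then (if (j < tau)%N then a else c)
  else (if (j < tau)%N then c else b).

Lemma sum_before (R : realType) (n : nat) (s : 'S_n) tau t :
  \sum_(i < n | (i < t)%N) ((s i < tau)%N%:R : R) = (kperm tau s t)%:R.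
Proof.
rewrite /kperm -sum1_card natr_sum big_mkcond [RHS]big_mkcond /=.
by apply: eq_bigr => i _; rewrite inE; case: (i < t)%N; case: (s i < tau)%N.
Qed.

Lemma sum_after (R : realType) (n : nat) (s : 'S_n) tau t : (tau <= n)%N ->
  \sum_(i < n | (t <= i)%N) ((s i < tau)%N%:R : R) = tau%:R - (kperm tau s t)%:R.
Proof.
move=> taun; rewrite -sum_before.
have -> : tau%:R = \sum_(i < n) ((s i < tau)%N%:R : R).
  rewrite (reindex_inj (@perm_inj _ s^-1)) /=.
  under eq_bigr do rewrite permKV.
  have -> : tau%:R = \sum_(i < tau) (1 : R) by rewrite sumr_const card_ord.
  rewrite (big_ord_widen n (fun=> 1)) // big_mkcond /=.
  by apply: eq_bigr => i _; case: (i < tau)%N.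
rewrite [X in _ = X - _](bigID (fun i : 'I_n => (i < t)%N)) /= [RHS]addrC addKr.
by apply: eq_bigl => i; rewrite -leqNgt.
Qed.

Lemma card_before (R : realType) (n : nat) (t : nat) : (t <= n)%N ->
  \sum_(i < n | (i < t)%N) (1 : R) = t%:R.
Proof. by move=> tn; rewrite -(big_ord_widen n (fun=> 1)) // sumr_const card_ord. Qed.

Lemma card_after (R : realType) (n : nat) (t : nat) : (t <= n)%N ->
  \sum_(i < n | (t <= i)%N) (1 : R) = (n - t)%:R.
Proof.
move=> tn; rewrite natrB // -(card_before R tn).
have -> : n%:R = \sum_(i < n) (1 : R) by rewrite sumr_const card_ord.
rewrite [X in _ = X - _](bigID (fun i : 'I_n => (i < t)%N)) /= [RHS]addrC addKr.
by apply: eq_bigl => i; rewrite -leqNgt.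
Qed.

Lemma natr_bin2 (R : realType) t : (1 <= t)%N ->
  ('C(t, 2)%:R : R) = t%:R * (t%:R - 1) / 2.
Proof.
case: t => // t _; have := mul_bin_diag t.+1 1; rewrite bin1 /= => /(congr1 (fun k => k%:R : R)).
rewrite !natrM => E; apply: (mulfI (_ : 2 != 0 :> R)); first by rewrite pnatr_eq0.
by rewrite -E -natr1 addrK; field.
Qed.

(** Only the number of first-group observations before [t] matters. The block sums are polynomials
    in it, so the claim becomes an identity of rational functions; [2 <= t] and [t + 2 <= n] keep
    [t - 1] and [n - t - 1] nonzero. *)
Lemma split_gap_block (R : realType) (n tau t : nat) (s : 'S_n) (a b c : R) :
  (2 <= t)%N -> (t + 2 <= n)%N -> (tau <= n)%N ->
  let p := pperm R tau s t in let q := qperm R tau s t in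
  split_gap (fun i j => block_dist tau a b c (s i) (s j)) t =
  gap (c - b) (c - a) p q (t%:R - 1)^-1 ^+ 2 +
  gap (c - b) (c - a) q p (n%:R - t%:R - 1)^-1 ^+ 2.
Proof.
move=> t2 tn taun p q; rewrite /split_gap.
pose x (i : 'I_n) : R := (s i < tau)%N%:R.
have xx i : x i * x i = x i by rewrite /x; case: (_ < _)%N; rewrite ?mulr1 ?mulr0.
have E i j : i != j ->
    block_dist tau a b c (s i) (s j) = two_block x a b c i j.
  move=> ij; rewrite /block_dist (inj_eq perm_inj) (negPf ij) /two_block /x.
  by case: (s i < tau)%N; case: (s j < tau)%N => /=; ring.
pose A := fun i : 'I_n => (i < t)%N; pose B := fun i : 'I_n => (t <= i)%N.
have EA := within_two_block A a b c xx.
have EB := within_two_block B a b c xx.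
rewrite -/A -/B.
rewrite (eq_within A E) (eq_within B E).
have -> : pairs_across A B (fun i j => block_dist tau a b c (s i) (s j)) =
    pairs_across A B (two_block x a b c).
  apply: eq_bigr => i iA; apply: eq_bigr => j jB; apply: E.
  by apply/eqP => ij; move: iA jB; rewrite ij /A /B; lia.
have tn' : (t <= n)%N by lia.
rewrite across_two_block /=.
move: EA EB; rewrite /= !sumrB (card_before R tn') (card_after R tn').
rewrite (sum_before R s tau t) (sum_after R s t taun).
set WA := pairs_within _ _; set WB := pairs_within _ _.
set k : R := (kperm tau s t)%:R; set l := tau%:R - k.
have -> : p = k / t%:R by [].
have -> : q = l / (n - t)%:R by [].
rewrite !natr_bin2; try lia.
rewrite natrM natrB //.
move: (k) (l) => K L.
have T2 : (2 : R) <= t%:R by rewrite ler_nat.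
have TN : (t%:R + 2 : R) <= n%:R by rewrite -natrD ler_nat.
move: (t%:R) (n%:R) T2 TN => T N T2 TN EA EB.
have T0 : T != 0 by lra.
have T1 : T - 1 != 0 by lra.
have M0 : N - T != 0 by lra.
have M1 : N - T - 1 != 0 by lra.
have -> : WA = (2 * WA) / 2 by field.
have -> : WB = (2 * WB) / 2 by field.
rewrite EA EB /gap.
congr (_ ^+ 2 + _ ^+ 2); field; do ?[apply/andP; split] => //.
Qed.

(** * Maxima and weights over the window of admissible splits *)

Lemma le_bigmax_Aset (R : realType) (n m : nat) (f : nat -> R) t :
  t \in Aset n m -> f t <= \big[Num.max/0]_(m <= t' < (n - m).+1) f t'.
Proof.
move=> tA; apply: Order.TotalTheory.le_bigmax_seq => //.
by rewrite mem_index_iota ltnS.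
Qed.

(** The bound has to be positive because the iterated maximum starts from 0. *)
Lemma bigmax_Aset_lt (R : realType) (n m : nat) (f : nat -> R) x : 0 < x ->
  (forall t, t \in Aset n m -> f t < x) ->
  \big[Num.max/0]_(m <= t' < (n - m).+1) f t' < x.
Proof.
move=> x0 fx; rewrite big_nat_cond; apply: bigmax_lt => // i.
by rewrite andbT ltnS => iA; apply: fx.
Qed.

Lemma weight_le4 (R : realType) (n t : nat) : (t <= n)%N -> 0 <= weight R n t <= 1 / 4.
Proof.
move=> tn; rewrite /weight divr_ge0 ?ler0n ?sqr_ge0 //=.
case: n tn => [|n] tn; first by rewrite expr0n /= invr0 mulr0; lra.
rewrite ler_pdivrMr ?exprn_gt0 ?ltr0n // natrM natrB //.
have := sqr_ge0 (n.+1%:R - 2 * t%:R : R); nra.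
Qed.

Lemma weight_sym (R : realType) (n t : nat) : (t <= n)%N ->
  weight R n (n - t) = weight R n t.
Proof. by move=> tn; rewrite /weight subKn // mulnC. Qed.

(** [w(t) / (t - 1)] is largest at the left end of the window, because the cross-multiplied
    difference factors as [(T - M) (N - M + T (M - 1))]. A further decreasing factor [1 / (t - 1)]
    gives the second inequality. *)
Lemma weight_div_le (R : realType) (n m t : nat) : (2 <= m)%N -> t \in Aset n m ->
  weight R n t / (t%:R - 1) <= weight R n m / (m%:R - 1) /\
  weight R n t / (t%:R - 1) ^+ 2 <= weight R n m / (m%:R - 1) ^+ 2.
Proof.
move=> m2 /andP[mt tn].
have M2 : (2 : R) <= m%:R by rewrite ler_nat.
have MT : (m%:R : R) <= t%:R by rewrite ler_nat.
have TN : (t%:R : R) + m%:R <= n%:R by rewrite -natrD ler_nat; lia.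
have tn' : (t <= n)%N by lia.
have mn' : (m <= n)%N by lia.
rewrite /weight !natrM !natrB //.
move: (m%:R) (t%:R) (n%:R) M2 MT TN => M T N M2 MT TN.
have H0 : T * (N - T) / (T - 1) <= M * (N - M) / (M - 1).
  rewrite ler_pdivrMr; last lra.
  have -> : M * (N - M) / (M - 1) * (T - 1) = (M * (N - M) * (T - 1)) / (M - 1).
    by field; lra.
  rewrite ler_pdivlMr; last lra.
  rewrite -subr_ge0.
  have -> : M * (N - M) * (T - 1) - T * (N - T) * (M - 1) =
    (T - M) * (N - M + T * (M - 1)) by ring.
  apply: mulr_ge0; nra.
have H1 : T * (N - T) / N ^+ 2 / (T - 1) <= M * (N - M) / N ^+ 2 / (M - 1).
  rewrite -![_ / N ^+ 2 / _]mulrA ![(N ^+ 2)^-1 * _]mulrC !mulrA.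
  by apply: ler_wpM2r H0; rewrite invr_ge0 sqr_ge0.
split=> //; rewrite !expr2 !invfM !mulrA in H1 *.
apply: ler_pM => //.
- by rewrite !mulr_ge0 ?invr_ge0 //; lra.
- by rewrite invr_ge0; lra.
- by rewrite lef_pV2 ?posrE; lra.
Qed.

Lemma kperm1 n tau t : (t <= n)%N -> (tau <= n)%N ->
  kperm tau (1%g : 'S_n) t = minn t tau.
Proof.
move=> tn taun; rewrite /kperm -sum1_card.
have -> : minn t tau = \sum_(i < minn t tau) 1 by rewrite sum1_card card_ord.
rewrite (big_ord_widen n (fun=> 1%N)) ?geq_min ?tn //.
by apply: eq_bigl => i; rewrite inE perm1 leq_min.
Qed.

(** * Strict maximality of the limiting scan at the change point *)

Definition limit_scan (R : realType) (n tau : nat) (a b c : R) (s : 'S_n) (t : nat) : R :=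
  weight R n t * split_gap (fun i j => block_dist tau a b c (s i) (s j)) t.

Lemma weight_gt0 (R : realType) (n t : nat) : (0 < t < n)%N -> 0 < weight R n t.
Proof.
move=> tn; rewrite /weight divr_gt0 ?exprn_gt0 // ltr0n ?muln_gt0; lia.
Qed.

(** At the true split both sides are pure, [p = 1] and [q = 0], so the correction terms vanish and
    the gaps are [c - a] and [c - b]. *)
Lemma limit_scan_change (R : realType) (n m tau : nat) (a b c : R) :
  (2 <= m)%N -> tau \in Aset n m ->
  limit_scan tau a b c (1%g : 'S_n) tau = weight R n tau * ((c - b) ^+ 2 + (c - a) ^+ 2).
Proof.
move=> m2 /andP[mt tn].
rewrite /limit_scan split_gap_block; [|lia..].
rewrite /pperm /qperm kperm1 ?minnn; [|lia..].
rewrite subrr mul0r divff ?pnatr_eq0; last by lia.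
by rewrite /gap; congr (_ * _); rewrite addrC; congr (_ + _); ring.
Qed.

Lemma limit_scan_change_gt0 (R : realType) (n m tau : nat) (a b c : R) :
  (2 <= m)%N -> tau \in Aset n m -> a + b < 2 * c ->
  0 < limit_scan tau a b c (1%g : 'S_n) tau.
Proof.
move=> m2 tauA abc; rewrite (limit_scan_change _ _ _ m2 tauA) mulr_gt0 //.
  by apply: weight_gt0; case/andP: tauA; lia.
by apply: sum_sqr_gt0; lra.
Qed.

Lemma limit_scan_lt (R : realType) (n m tau : nat) (a b c : R) t :
  (2 <= m)%N -> tau \in Aset n m -> a + b < 2 * c -> t \in Aset n m -> t != tau ->
  limit_scan tau a b c (1%g : 'S_n) t < limit_scan tau a b c (1%g : 'S_n) tau.
Proof.
move=> m2 tauA abc tA ttau; rewrite (limit_scan_change _ _ _ m2 tauA) /limit_scan.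
have /andP[mtau taun] := tauA; have /andP[mt tn] := tA.
rewrite split_gap_block; [|lia..].
rewrite /weight ![_ / n%:R ^+ 2 * _]mulrAC ltr_pM2r; last first.
  by rewrite invr_gt0 exprn_gt0 // ltr0n; lia.
have S0 : 0 < (c - b) ^+ 2 + (c - a) ^+ 2 by apply: sum_sqr_gt0; lra.
rewrite /pperm /qperm kperm1; [|lia..].
have tn' : (t <= n)%N by lia.
have taun' : (tau <= n)%N by lia.
rewrite !natrM !natrB //.
have NT : (2 : R) <= n%:R - tau%:R by rewrite -natrB // ler_nat; lia.
have T2 : (2 : R) <= tau%:R by rewrite ler_nat; lia.
have [tlt|tgt|/eqP] := ltngtP t tau; last by rewrite (negPf ttau).
- have tT : (t%:R + 1 : R) <= tau%:R by rewrite natr1 ler_nat.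
  have t1 : (1 : R) <= t%:R by rewrite ler1n; lia.
  rewrite divff; last by rewrite pnatr_eq0; lia.
  by apply: early_split_lt => //; lra.
- have tT : (tau%:R + 1 : R) <= t%:R by rewrite natr1 ler_nat.
  have t1 : (t%:R + 1 : R) <= n%:R by rewrite natr1 ler_nat; lia.
  rewrite subrr mul0r.
  by apply: late_split_lt.
Qed.

(** Completing the square: with [x = w(m) / (m - 1)], the sum [rho + 2 x] is the square root in the
    definition of [rho]. *)
Lemma rho_root (R : realType) (n m tau : nat) :
  (2 <= m)%N -> tau \in Aset n m -> 0 <= rho R n m tau ->
  rho R n m tau ^+ 2 / 2 + 2 * rho R n m tau * (weight R n m / (m%:R - 1)) +
    weight R n m / (m%:R - 1) ^+ 2 / 2 = weight R n tau.
Proof.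
move=> m2 /andP[mtau taun].
have M2 : (2 : R) <= m%:R by rewrite ler_nat.
have w0 : 0 < weight R n m.
  by apply: weight_gt0; lia.
rewrite /rho; set w := weight R n m in w0 *; set x := w / (m%:R - 1).
have x0 : 0 < x by rewrite divr_gt0 //; lra.
set E := (X in Num.sqrt X) => r0.
(* A negative radicand would have square root 0, hence [rho = - 2 x < 0], against the hypothesis. *)
have E0 : 0 <= E.
  rewrite leNgt; apply/negP => Elt; move: r0; rewrite ltr0_sqrtr //; lra.
have := sqr_sqrtr E0; move: (Num.sqrt E) r0 => r r0 rE.
have -> : w / (m%:R - 1) ^+ 2 / 2 = w / (2 * (m%:R - 1) ^+ 2) by field; lra.
by move: rE; rewrite /E -/x; nra.
Qed.

(** The bounds [x = w(m) / (m - 1)] and [y = w(m) / (m - 1)^2] are uniform over the window, so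
    [balanced_split_lt] at [r = rho] leads to the quadratic whose value is [w(tau)]. *)
Lemma limit_scan_balanced (R : realType) (n m tau : nat) (a b c : R) (s : 'S_n) t :
  (2 <= m)%N -> tau \in Aset n m -> a + b < 2 * c -> t \in Aset n m ->
  s \notin unbalanced n m tau (rho R n m tau) ->
  limit_scan tau a b c s t < limit_scan tau a b c (1%g : 'S_n) tau.
Proof.
move=> m2 tauA abc tA; rewrite inE -leNgt => sB.
have /andP[mtau taun] := tauA; have /andP[mt tn] := tA.
have tn' : (t <= n)%N by lia.
have mn' : (m <= n)%N by lia.
have t2n : (t + 2 <= n)%N by lia.
have t2' : (2 <= t)%N by lia.
(* The second gap carries [1 / (n - t - 1)]; the window bounds apply to it at the reflected split
   [n - t]. *)
have tmem : (n - t)%N \in Aset n m by apply/andP; split; lia.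
have t2 : (2 : R) <= t%:R by rewrite ler_nat; lia.
have nt2 : (2 : R) <= n%:R - t%:R by rewrite -natrB // ler_nat; lia.
have wm0 : 0 < weight R n m by apply: weight_gt0; lia.
have M2 : (2 : R) <= m%:R by rewrite ler_nat.
have pq := le_trans (le_bigmax_Aset (fun t => `|pperm R tau s t - qperm R tau s t|) tA) sB.
(* A balanced permutation forces [rho] to be nonnegative, since it bounds an absolute value;
   [rho_root] asks for this. *)
have r0 : 0 <= rho R n m tau by apply: le_trans pq.
rewrite (limit_scan_change _ _ _ m2 tauA) -(rho_root m2 tauA r0).
rewrite /limit_scan split_gap_block //; last exact: leq_trans taun (leq_subr _ _).
have [w1 w2] := weight_div_le R m2 tA.
have [] := weight_div_le R m2 tmem; rewrite weight_sym // natrB // => w1' w2'.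
have k1 : (kperm tau s t)%:R <= t%:R :> R.
  rewrite -(sum_before R s tau t) -(card_before R tn').
  by apply: ler_sum => i _; rewrite lern1 leq_b1.
have k0 : (0 : R) <= (kperm tau s t)%:R by rewrite ler0n.
have l0 : (0 : R) <= tau%:R - (kperm tau s t)%:R.
  by rewrite -(sum_after R s t (leq_trans taun (leq_subr _ _))) sumr_ge0 // => i _; rewrite ler0n.
have l1 : tau%:R - (kperm tau s t)%:R <= (n - t)%:R :> R.
  rewrite -(sum_after R s t (leq_trans taun (leq_subr _ _))) -(card_after R tn').
  by apply: ler_sum => i _; rewrite lern1 leq_b1.
apply: balanced_split_lt => //.
- by rewrite /pperm divr_ge0 ?ler0n //= ler_pdivrMr ?mul1r //; lra.
- rewrite /qperm natrB // in l1 *.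
  by rewrite divr_ge0 //=; [rewrite ler_pdivrMr ?mul1r //; lra|lra].
- by rewrite invr_ge0; lra.
- by rewrite invr_ge0; lra.
- exact: weight_le4.
- by rewrite exprVn.
- by rewrite exprVn.
- by rewrite divr_ge0; lra.
- by rewrite divr_gt0 // exprn_gt0; lra.
- lra.
Qed.

(** * Stability under perturbation of the distances *)

(** Homogeneity of degree 2 removes the normalisation by the square root of the dimension from
    comparisons of scans. *)
Lemma split_gapZ (R : realType) n (k : R) (D : 'I_n -> 'I_n -> R) t :
  split_gap (fun i j => k * D i j) t = k ^+ 2 * split_gap D t.
Proof.
have EW (A : pred 'I_n) : pairs_within A (fun i j => k * D i j) = k * pairs_within A D.
  by rewrite /pairs_within mulr_sumr; apply: eq_bigr => i _; rewrite mulr_sumr.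
have EA (A B : pred 'I_n) : pairs_across A B (fun i j => k * D i j) = k * pairs_across A B D.
  by rewrite /pairs_across mulr_sumr; apply: eq_bigr => i _; rewrite mulr_sumr.
by rewrite /split_gap !EW EA; ring.
Qed.

Lemma cvg_sumr (R : realType) (T I : Type) (F : set_system T) {FF : Filter F}
    (r : seq I) (P : pred I) (f : I -> T -> R) (l : I -> R) :
  (forall i, P i -> f i x @[x --> F] --> l i) ->
  \sum_(i <- r | P i) f i x @[x --> F] --> \sum_(i <- r | P i) l i.
Proof. by move=> fl; apply: cvg_big => //; exact: add_continuous. Qed.

Lemma cvg_split_gap (R : realType) n (s : 'S_n) t (M : 'M[R]_n) :
  (fun D : 'M[R]_n => split_gap (fun i j => D (s i) (s j)) t) @ M -->
  split_gap (fun i j => M (s i) (s j)) t.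
Proof.
have cW (A : pred 'I_n) : (fun D : 'M[R]_n => pairs_within A (fun i j => D (s i) (s j))) @ M -->
    pairs_within A (fun i j => M (s i) (s j)).
  rewrite /pairs_within /pairs_across; do 2 (apply: (@cvg_sumr R _ _ (nbhs M)) => ? _).
  exact: coord_continuous.
have cA (A B : pred 'I_n) : (fun D : 'M[R]_n => pairs_across A B (fun i j => D (s i) (s j))) @ M -->
    pairs_across A B (fun i j => M (s i) (s j)).
  rewrite /pairs_within /pairs_across; do 2 (apply: (@cvg_sumr R _ _ (nbhs M)) => ? _).
  exact: coord_continuous.
have sq (k k' : R) (f g : 'M[R]_n -> R) (x y : R) : f @ M --> x -> g @ M --> y ->
    (fun D => (k * f D - k' * g D) ^+ 2) @ M --> (k * x - k' * y) ^+ 2.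
  move=> fx gy; have h : (fun D => k * f D - k' * g D) @ M --> k * x - k' * y.
    exact: (cvgB (cvgM (cvg_cst k) fx) (cvgM (cvg_cst k') gy)).
  exact: (cvgM h h).
exact: (cvgD (sq _ _ _ _ _ _ (cA _ _) (cW _)) (sq _ _ _ _ _ _ (cA _ _) (cW _))).
Qed.

Lemma near_scan_lt (R : realType) n (w w' : R) (s s' : 'S_n) t t' (M : 'M[R]_n) :
  w * split_gap (fun i j => M (s i) (s j)) t <
    w' * split_gap (fun i j => M (s' i) (s' j)) t' ->
  \forall D \near M, w * split_gap (fun i j => (D : 'M[R]_n) (s i) (s j)) t <
    w' * split_gap (fun i j => D (s' i) (s' j)) t'.
Proof.
move=> lt0.
have h : (fun D : 'M[R]_n => w' * split_gap (fun i j => D (s' i) (s' j)) t' -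
    w * split_gap (fun i j => D (s i) (s j)) t) @ M -->
    w' * split_gap (fun i j => M (s' i) (s' j)) t' -
    w * split_gap (fun i j => M (s i) (s j)) t.
  have c := @cvg_split_gap R n s t M; have c' := @cvg_split_gap R n s' t' M.
  exact: (cvgB (cvgM (cvg_cst w') c') (cvgM (cvg_cst w) c)).
rewrite -subr_gt0 in lt0.
apply: (filterS _ (cvgr_gt _ h 0 lt0)) => D.
by rewrite subr_gt0.
Qed.

(** Both conclusions follow from these strict inequalities alone. Positivity at [tau] lets the
    maximum exceed the value 0 built into [Shat] and [chat]. *)
Definition change_separated (R : realType) n m tau (D : 'I_n -> 'I_n -> R) : Prop :=
  [/\ 0 < weight R n tau * split_gap D tau,
    forall t, t \in Aset n m -> t != tau ->
      weight R n t * split_gap D t < weight R n tau * split_gap D tau &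
    forall (s : 'S_n) t, s \notin unbalanced n m tau (rho R n m tau) -> t \in Aset n m ->
      weight R n t * split_gap (fun i j => D (s i) (s j)) t <
      weight R n tau * split_gap D tau].

Lemma near_change_separated (R : realType) n m tau (a b c : R) :
  (2 <= m)%N -> tau \in Aset n m -> a + b < 2 * c ->
  exists2 e : R, 0 < e & forall D : 'I_n -> 'I_n -> R, (forall i, D i i = 0) ->
    (forall i j, i != j -> `|D i j - block_dist tau a b c i j| < e) ->
    change_separated m tau D.
Proof.
move=> m2 tauA abc.
pose M : 'M[R]_n := \matrix_(i, j) block_dist tau a b c i j.
have ME s t : split_gap (fun i j => M (s i) (s j)) t =
    split_gap (fun i j => block_dist tau a b c (s i) (s j)) t.
  by congr (split_gap _ t); apply/funext => i; apply/funext => j; rewrite mxE.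
have FM := nbhs_filter M.
(* The zero weight on the left presents positivity as a comparison of two scans, so [near_scan_lt]
   covers it too. *)
have n1 : \forall D \near M,
   0 * split_gap (fun i j => (D : 'M[R]_n) ((1%g : 'S_n) i) ((1%g : 'S_n) j)) tau <
   weight R n tau * split_gap (fun i j => D ((1%g : 'S_n) i) ((1%g : 'S_n) j)) tau.
  by apply: near_scan_lt; rewrite mul0r ME; exact: (limit_scan_change_gt0 m2 tauA abc).
(* Splits are taken in the finite type ['I_n.+1], so that only finitely many neighbourhoods are
   intersected. *)
have n2 : \forall D \near M, forall t : 'I_n.+1,
    nat_of_ord t \in Aset n m -> nat_of_ord t != tau ->
    weight R n t * split_gap (fun i j => (D : 'M[R]_n) ((1%g : 'S_n) i) ((1%g : 'S_n) j)) t <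
    weight R n tau * split_gap (fun i j => D ((1%g : 'S_n) i) ((1%g : 'S_n) j)) tau.
  apply: (filter_forall FM) => t.
  have [tA|tA] := boolP (nat_of_ord t \in Aset n m);
    last by apply: (filterE FM).
  have [|ttau] := eqVneq (nat_of_ord t) tau;
    first by move=> ttau; apply: (filterE FM).
  have := @near_scan_lt R n (weight R n t) (weight R n tau) 1%g 1%g t tau M.
  rewrite !ME => /(_ (limit_scan_lt m2 tauA abc tA ttau)).
  by move=> h; apply: (filterS _ h).
have n3 : \forall D \near M, forall s : 'S_n, forall t : 'I_n.+1,
    s \notin unbalanced n m tau (rho R n m tau) -> nat_of_ord t \in Aset n m ->
    weight R n t * split_gap (fun i j => (D : 'M[R]_n) (s i) (s j)) t <
    weight R n tau * split_gap (fun i j => D ((1%g : 'S_n) i) ((1%g : 'S_n) j)) tau.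
  apply: (filter_forall FM) => s; apply: (filter_forall FM) => t.
  have [tA|tA] := boolP (nat_of_ord t \in Aset n m); last first.
    by apply: (filterE FM).
  have [sB|sB] := boolP (s \in unbalanced n m tau (rho R n m tau)).
    by apply: (filterE FM).
  have := @near_scan_lt R n (weight R n t) (weight R n tau) s 1%g t tau M.
  rewrite !ME => /(_ (limit_scan_balanced m2 tauA abc tA sB)).
  by move=> h; apply: (filterS _ h).
have [e /= e0 eP] := (nbhs_ballP _ _).1 (filterI n1 (filterI n2 n3)).
exists e => // D D0 De.
pose D' : 'M[R]_n := \matrix_(i, j) D i j.
have DE s t : split_gap (fun i j => D' (s i) (s j)) t =
    split_gap (fun i j => D (s i) (s j)) t.
  by congr (split_gap _ t); apply/funext => i; apply/funext => j; rewrite mxE.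
have /eP /= [] : ball M e D'.
  split=> // i j; rewrite /ball /= !mxE distrC.
  have [->|ij] := eqVneq i j; last exact: De.
  by rewrite D0 /block_dist eqxx subrr normr0.
have E1 t : split_gap (fun i j => D ((1%g : 'S_n) i) ((1%g : 'S_n) j)) t = split_gap D t.
  by congr (split_gap _ t); apply/funext => i; apply/funext => j; rewrite !perm1.
rewrite mul0r DE E1 => h1 [h2 h3].
have tlt t : t \in Aset n m -> (t < n.+1)%N by move=> /andP[_ ?]; rewrite ltnS; lia.
split=> //.
- move=> t tA ttau; have := h2 (Ordinal (tlt _ tA)) tA ttau.
  by rewrite !DE !E1.
- move=> s t sB tA; have := h3 s (Ordinal (tlt _ tA)) sB tA.
  by rewrite !DE.
Qed.

(** Replaces the infimum by a finite count, which gives both the detection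
    criterion and the measurability of the detection event. *)
Lemma chat_lt_Shat (R : realType) n d m (z : 'I_n -> d.-tuple R) (alpha : R) :
  0 < alpha ->
  chat m z alpha < Shat m z <->
  0 < Shat m z /\
  1 - alpha <= (n`!)%:R^-1 *
    \sum_(s : 'S_n) (Shat m (fun i => z (s i)) < Shat m z)%R%:R.
Proof.
move=> a0; set S := Shat m z; pose Sp (s : 'S_n) := Shat m (fun i => z (s i)).
have cS : #|{: 'S_n}| = n`! by rewrite -(card_Sn n); apply: eq_card => s; rewrite !inE.
have F0 : 0 < (n`!)%:R^-1 :> R by rewrite invr_gt0 ltr0n fact_gt0.
split.
- move=> /inf_lt [|x [x0 xa] xS].
    (* Nonemptiness: the largest permuted statistic is admissible, as the permutation distribution
       function equals 1 there. *)
    pose y : R := \big[Num.max/0]_(s : 'S_n) Sp s.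
    exists y; split; first by apply: bigmax_ge_id.
    rewrite /perm_cdf (eq_bigr (fun=> 1)) => [|s _].
      rewrite sumr_const cS mulVf ?pnatr_eq0 -?lt0n ?fact_gt0 //; lra.
    have Sy : Sp s <= y by exact: le_bigmax.
    by rewrite Sy.
  split; first exact: le_lt_trans xS.
  apply: le_trans xa _; rewrite /perm_cdf ler_pM2l //; apply: ler_sum => s _.
  rewrite -/(Sp s); have [Sx|_] := leP (Sp s) x; last by rewrite ler0n.
  by rewrite (le_lt_trans Sx xS).
- move=> [S0 hS].
  (* The largest permuted statistic strictly below [S], or 0 if there is none: it attains the
     required count and still lies below [S]. *)
  pose y : R := \big[Num.max/0]_(s : 'S_n | Sp s < S) Sp s.
  apply: (@le_lt_trans _ _ y); last by apply: bigmax_lt.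
  apply: ge_inf; first by exists 0 => r [].
  split; first by apply: bigmax_ge_id.
  apply: le_trans hS _; rewrite /perm_cdf ler_pM2l //; apply: ler_sum => s _.
  rewrite -/(Sp s); have [Sx|_] := ltP (Sp s) S; last by rewrite ler0n.
  have Sy : Sp s <= y by exact: (@le_bigmax_cond _ _ _ 0 s (fun s => Sp s < S) Sp Sx).
  by rewrite Sy.
Qed.

(** * Moments of squared differences under a product law *)

Section Moments.
Local Open Scope ereal_scope.
Context d (T : measurableType d) (R : realType) (P : probability T R).

Lemma ge0_Lfun1 (X : T -> R) : measurable_fun [set: T] X ->
  (forall x, (0 <= X x)%R) -> 'E_P[X] < +oo -> X \in Lfun P 1.
Proof.
move=> mX X0; rewrite unlock => Xoo; apply/Lfun1_integrable/integrableP; split.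
  exact/measurable_EFinP.
by under eq_integral do rewrite gee0_abs ?lee_fin //.
Qed.

Lemma le_Lfun1 (X Y : T -> R) : measurable_fun [set: T] X ->
  (forall x, (`|X x| <= Y x)%R) -> Y \in Lfun P 1 -> X \in Lfun P 1.
Proof.
move=> mX XY /Lfun1_integrable iY; apply/Lfun1_integrable.
apply: (le_integrable measurableT _ _ iY); first exact/measurable_EFinP.
by move=> x _ /=; rewrite lee_fin (le_trans (XY x)) // ler_norm.
Qed.

Lemma sqr_Lfun2 (X : T -> R) : measurable_fun [set: T] X ->
  (X ^+ 2)%R \in Lfun P 1 -> X \in Lfun P 2%:E.
Proof.
move=> mX /Lfun1_integrable /integrableP [_ iX].
rewrite inE; apply/andP; split; rewrite inE //=.
rewrite /finite_norm unlock poweR_lty //.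
apply: le_lt_trans iX; apply: ge0_le_integral => //.
- by move=> t _; exact: poweR_ge0.
- apply/measurable_EFinP.
  apply/(@measurableT_comp _ _ _ _ _ _ (fun x : R => x `^ 2)%R) => //.
  exact/measurableT_comp.
- by apply: measurableT_comp => //; apply/measurable_EFinP; exact: (measurable_funM mX mX).
- by move=> t _; rewrite /= lee_fin powR_mulrn // -normrX; exact: lexx.
Qed.

Lemma integral_expectation (X : T -> R) : \int[P]_x (X x)%:E = 'E_P[X].
Proof. by rewrite unlock. Qed.

Lemma expectation_affine (X : T -> R) (k c : R) : X \in Lfun P 1 ->
  'E_P[fun x => (k * X x + c)%R] = (k * fine 'E_P[X] + c)%:E.
Proof.
move=> X1.
have -> : (fun x => (k * X x + c)%R) = ((k \o* X) \+ cst c)%R.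
  by apply/funext => x /=; rewrite mulrC.
rewrite expectationD ?Lfun_cst ?Lfun_scale //.
by rewrite expectationZl // expectation_cst EFinD EFinM fineK ?expectation_fin_num.
Qed.

Lemma expectation_quadratic (X : T -> R) (k b c : R) : X \in Lfun P 2%:E ->
  'E_P[fun x => (k * X x ^+ 2 + b * X x + c)%R] =
  (k * fine 'E_P[X ^+ 2] + b * fine 'E_P[X] + c)%:E.
Proof.
move=> X2.
have X1 : X \in Lfun P 1 by apply: Lfun_subset12 X2; exact: fin_num_measure.
have XX1 : (X ^+ 2)%R \in Lfun P 1 by exact: Lfun2_mul_Lfun1.
have -> : (fun x => (k * X x ^+ 2 + b * X x + c)%R) =
    ((k \o* (X ^+ 2)%R) \+ (fun x => b * X x + c))%R.
  by apply/funext => x /=; rewrite addrA mulrC.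
rewrite expectationD ?Lfun_scale //; last first.
  have -> : (fun x => (b * X x + c)%R) = ((b \o* X) \+ cst c)%R.
    by apply/funext => x /=; rewrite mulrC.
  by rewrite rpredD ?Lfun_cst ?Lfun_scale.
rewrite expectationZl // expectation_affine // -[X in k%:E * X]fineK ?expectation_fin_num //.
by rewrite -EFinM -EFinD addrA.
Qed.

(** Square integrability comes from [x^2 <= x^4 + 1]. *)
Lemma fourth_moment_Lfun (X : T -> R) (C : R) : measurable_fun [set: T] X ->
  'E_P[fun x => (X x ^+ 4)%R] <= C%:E ->
  (fun x => (X x ^+ 4)%R) \in Lfun P 1 /\ X \in Lfun P 2%:E.
Proof.
move=> mX XC.
have X4 : (fun x => (X x ^+ 4)%R) \in Lfun P 1.
  apply: ge0_Lfun1; first exact: measurable_funX.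
    by move=> x; rewrite (exprM _ 2 2) sqr_ge0.
  by rewrite (le_lt_trans XC) // ltry.
split=> //; apply: sqr_Lfun2 => //.
apply: (@le_Lfun1 _ ((fun x => (X x ^+ 4)%R) \+ cst 1)%R).
- exact: (measurable_funM mX mX).
- move=> x /=; rewrite ger0_norm ?sqr_ge0 // (exprM _ 2 2).
  have -> : (X ^+ 2)%R x = (X x ^+ 2)%R by [].
  by have := sqr_ge0 (X x ^+ 2 - 1)%R; nra.
- by rewrite rpredD // Lfun_cst.
Qed.

End Moments.

Section SquaredDifference.
Local Open Scope ereal_scope.
Context d1 d2 (T1 : measurableType d1) (T2 : measurableType d2) (R : realType).
Context (P1 : probability T1 R) (P2 : probability T2 R).

Lemma expectation_prod (f : T1 * T2 -> R) : measurable_fun [set: T1 * T2] f ->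
  (forall z, (0 <= f z)%R) ->
  'E_(P1 \x P2)[f] = \int[P1]_x 'E_P2[fun y => f (x, y)].
Proof.
move=> mf f0; rewrite unlock fubini_tonelli1 //; exact/measurable_EFinP.
Qed.

Lemma measurable_sub_prod (X : T1 -> R) (Y : T2 -> R) :
  measurable_fun [set: T1] X -> measurable_fun [set: T2] Y ->
  measurable_fun [set: T1 * T2] (fun z => X z.1 - Y z.2)%R.
Proof.
move=> mX mY; apply: measurable_funB.
  by apply: (measurableT_comp mX); exact: measurable_fst.
by apply: (measurableT_comp mY); exact: measurable_snd.
Qed.

(** By Tonelli the expectation is taken first in the second variable and then in the first, each
    time of a quadratic polynomial. Summed over coordinates, this gives the mean squared
    distance. *)
Lemma expectation_sqr_diff (X : T1 -> R) (Y : T2 -> R) :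
  measurable_fun [set: T1] X -> measurable_fun [set: T2] Y ->
  X \in Lfun P1 2%:E -> Y \in Lfun P2 2%:E ->
  'E_(P1 \x P2)[fun z => ((X z.1 - Y z.2) ^+ 2)%R] =
  (fine 'V_P1[X] + fine 'V_P2[Y] + (fine 'E_P1[X] - fine 'E_P2[Y]) ^+ 2)%:E.
Proof.
move=> mX mY X2 Y2.
rewrite expectation_prod; last 2 first.
- by apply: measurable_funX; exact: measurable_sub_prod.
- by move=> z; exact: sqr_ge0.
have inner x : 'E_P2[fun y => ((X (x, y).1 - Y (x, y).2) ^+ 2)%R] =
    (1 * X x ^+ 2 + (- 2 * fine 'E_P2[Y]) * X x + fine 'E_P2[Y ^+ 2])%:E.
  have -> : (fun y => (X (x, y).1 - Y (x, y).2) ^+ 2)%R =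
      (fun y => 1 * Y y ^+ 2 + (- 2 * X x) * Y y + X x ^+ 2)%R.
    by apply/funext => y /=; ring.
  by rewrite expectation_quadratic //; congr EFin; ring.
under eq_integral do rewrite inner.
rewrite integral_expectation expectation_quadratic //.
have vE d (T : measurableType d) (P : probability T R) (V : T -> R) : V \in Lfun P 2%:E ->
    (fine 'V_P[V] = fine 'E_P[V ^+ 2] - fine 'E_P[V] ^+ 2)%R.
  move=> V2; have V1 : V \in Lfun P 1 by apply: Lfun_subset12 V2; exact: fin_num_measure.
  have VV1 : (V ^+ 2)%R \in Lfun P 1 by exact: Lfun2_mul_Lfun1.
  rewrite varianceE // fineB ?expectation_fin_num //; last first.
    by rewrite expe2 fin_numM ?expectation_fin_num.
  by rewrite expe2 fineM ?expectation_fin_num // expr2.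
by rewrite !vE //; congr EFin; ring.
Qed.

(** The constant comes from [(a - b)^4 <= 8 (a^4 + b^4)], obtained by squaring
    [(a - b)^2 <= 2 (a^2 + b^2)] and using convexity once more. *)
Lemma expectation_quartic_diff (X : T1 -> R) (Y : T2 -> R) (C : R) :
  measurable_fun [set: T1] X -> measurable_fun [set: T2] Y ->
  'E_P1[fun x => (X x ^+ 4)%R] <= C%:E -> 'E_P2[fun y => (Y y ^+ 4)%R] <= C%:E ->
  'E_(P1 \x P2)[fun z => ((X z.1 - Y z.2) ^+ 4)%R] <= (16 * C)%:E.
Proof.
move=> mX mY XC YC.
have [X4 _] := fourth_moment_Lfun mX XC.
have [Y4 _] := fourth_moment_Lfun mY YC.
have mX4 : measurable_fun setT (fun z : T1 * T2 => X z.1 ^+ 4)%R.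
  by apply: measurable_funX; apply: (measurableT_comp mX); exact: measurable_fst.
have mY4 : measurable_fun setT (fun z : T1 * T2 => Y z.2 ^+ 4)%R.
  by apply: measurable_funX; apply: (measurableT_comp mY); exact: measurable_snd.
have mm : measurable_fun setT (fun z : T1 * T2 => 8 * X z.1 ^+ 4 + 8 * Y z.2 ^+ 4)%R.
  by apply: measurable_funD; apply: measurable_funM.
have ge4 (r : R) : (0 <= r ^+ 4)%R by rewrite (exprM _ 2 2) sqr_ge0.
have ge8 z : (0 <= 8 * X z.1 ^+ 4 + 8 * Y z.2 ^+ 4)%R by rewrite addr_ge0 // mulr_ge0.
apply: le_trans (_ : 'E_(P1 \x P2)[fun z => (8 * X z.1 ^+ 4 + 8 * Y z.2 ^+ 4)%R] <= _).
  apply: expectation_le => //.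
    by apply: measurable_funX; exact: measurable_sub_prod.
  apply: aeW => -[x y] /=; move: (X x) (Y y) => a b.
  have h : ((a - b) ^+ 2 <= 2 * (a ^+ 2 + b ^+ 2))%R by have := sqr_ge0 (a + b)%R; nra.
  rewrite !(exprM _ 2 2); apply: le_trans (_ : ((2 * (a ^+ 2 + b ^+ 2)) ^+ 2 <= _)%R).
    by rewrite ler_sqr // nnegrE ?sqr_ge0 // mulr_ge0 // addr_ge0 ?sqr_ge0.
  by have := sqr_ge0 (a ^+ 2 - b ^+ 2)%R; nra.
rewrite expectation_prod //.
have inner x : 'E_P2[fun y => (8 * X (x, y).1 ^+ 4 + 8 * Y (x, y).2 ^+ 4)%R] =
    (8 * X x ^+ 4 + 8 * fine 'E_P2[fun y => (Y y ^+ 4)%R])%:E.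
  have -> : (fun y => 8 * X (x, y).1 ^+ 4 + 8 * Y (x, y).2 ^+ 4)%R =
      (fun y => 8 * Y y ^+ 4 + 8 * X x ^+ 4)%R by apply/funext => y /=; ring.
  by rewrite (expectation_affine _ _ Y4); congr EFin; ring.
under eq_integral do rewrite inner.
rewrite integral_expectation (expectation_affine _ _ X4).
rewrite lee_fin.
have : (fine 'E_P1[fun x => (X x ^+ 4)%R] <= C)%R.
  by rewrite -lee_fin fineK // expectation_fin_num.
have : (fine 'E_P2[fun x => (Y x ^+ 4)%R] <= C)%R.
  by rewrite -lee_fin fineK // expectation_fin_num.
lra.
Qed.

End SquaredDifference.

(** * Concentration of the distances *)

Section WeakLaw.
Local Open Scope ereal_scope.
Context dO (T : measurableType dO) (R : realType) (P : probability T R).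

Lemma Lfun21 (X : T -> R) : X \in Lfun P 2%:E -> X \in Lfun P 1.
Proof. by apply: Lfun_subset12; exact: fin_num_measure. Qed.

Lemma fine_covarianceK (X Y : T -> R) : X \in Lfun P 2%:E -> Y \in Lfun P 2%:E ->
  (fine (covariance P X Y))%:E = covariance P X Y.
Proof.
move=> X2 Y2; rewrite fineK //; apply: covariance_fin_num.
- exact: Lfun21.
- exact: Lfun21.
- exact: Lfun2_mul_Lfun1.
Qed.

(** The covariance is the correlation times the square root of the product of the variances, and
    that root is at most [K]. *)
Lemma covariance_le_corr (X Y : T -> R) (K : R) :
  X \in Lfun P 2%:E -> Y \in Lfun P 2%:E ->
  'V_P[X] <= K%:E -> 'V_P[Y] <= K%:E ->
  covariance P X Y <= (`|corr P X Y| * K)%:E.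
Proof.
move=> X2 Y2; rewrite -(fineK (variance_fin_num X2)) -(fineK (variance_fin_num Y2)).
rewrite !lee_fin => vK vK'.
have := covariance_le X2 Y2.
rewrite -(fine_covarianceK X2 Y2) /corr.
have := fine_ge0 (variance_ge0 P X); have := fine_ge0 (variance_ge0 P Y).
rewrite -(fineK (variance_fin_num X2)) -(fineK (variance_fin_num Y2)) /=.
move: (fine (variance P X)) (fine (variance P Y)) (fine (covariance P X Y)) vK vK'.
move=> v v' c vK vK' v'0 v0; rewrite -EFinM !lee_fin -sqrtrM //.
set r := Num.sqrt _ => cr.
have r0 : (0 <= r)%R by exact: sqrtr_ge0.
have K0 : (0 <= K)%R by exact: le_trans vK.
have rK : (r <= K)%R.
  by rewrite -(ger0_norm K0) -sqrtr_sqr ler_wsqrtr // expr2 ler_pM.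
(* In the degenerate case [corr] is 0 by convention, but Cauchy-Schwarz already makes the covariance
   nonpositive. *)
have [r00|r00] := eqVneq r 0%R.
  by rewrite (le_trans cr) // r00 mulr_ge0.
rewrite -{1}[c](divfK r00); apply: le_trans (ler_wpM2l (normr_ge0 _) rK).
by rewrite ler_wpM2r // ler_norm.
Qed.

Lemma Lfun2_sum (I : Type) (r : seq I) (W : I -> T -> R) :
  (forall i, W i \in Lfun P 2%:E) -> (\sum_(i <- r) W i)%R \in Lfun P 2%:E.
Proof. by move=> W2; rewrite rpred_sum ?lee1n. Qed.

Lemma covariance_suml (I : Type) (r : seq I) (W : I -> T -> R) (Z : T -> R) :
  (forall i, W i \in Lfun P 2%:E) -> Z \in Lfun P 2%:E ->
  covariance P (\sum_(i <- r) W i)%R Z = \sum_(i <- r) covariance P (W i) Z.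
Proof.
move=> W2 Z2; elim: r => [|i r IH]; first by rewrite !big_nil covariance_cst_l.
rewrite !big_cons -IH; apply: covarianceDl => //.
exact: Lfun2_sum.
Qed.

Lemma variance_sum_le (d : nat) (W : 'I_d -> T -> R) (K : R) :
  (forall q, W q \in Lfun P 2%:E) -> (forall q, 'V_P[W q] <= K%:E) ->
  'V_P[(\sum_q W q)%R] <=
  (K * (d%:R + \sum_(q < d) \sum_(q' < d | q != q') `|corr P (W q) (W q')|))%:E.
Proof.
move=> W2 WK; rewrite /variance.
have S2 : (\sum_q W q)%R \in Lfun P 2%:E by exact: Lfun2_sum.
rewrite covariance_suml //.
rewrite [leRHS](_ : _ = \sum_(q < d)
    (K + \sum_(q' < d | q != q') `|corr P (W q) (W q')| * K)%:E); last first.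
  rewrite sumEFin; congr EFin; rewrite big_split /= sumr_const card_ord mulrDr mulr_natr.
  by congr (_ + _)%R; rewrite mulrC mulr_suml; apply: eq_bigr => q _; rewrite mulr_suml.
apply: lee_sum => q _; rewrite covarianceC covariance_suml // (bigD1 q) //=.
rewrite EFinD; apply: leeD; first exact: WK.
rewrite -sumEFin [leRHS](eq_bigl (fun q' => q' != q)); last by move=> q'; rewrite eq_sym.
by apply: lee_sum => q' _; rewrite covarianceC covariance_le_corr.
Qed.

Lemma fine_expectation_sum (I : Type) (r : seq I) (W : I -> T -> R) :
  (forall i, W i \in Lfun P 2%:E) ->
  (fine 'E_P[\sum_(i <- r) W i] = \sum_(i <- r) fine 'E_P[W i])%R.
Proof.
move=> W2; elim: r => [|i r IH]; first by rewrite !big_nil expectation_cst.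
rewrite !big_cons -IH.
have Wi := Lfun21 (W2 i).
have Wr : (\sum_(j <- r) W j)%R \in Lfun P 1 by apply: Lfun21; exact: Lfun2_sum.
rewrite -fineD ?expectation_fin_num //; congr fine.
exact: expectationD.
Qed.

Lemma weak_law_bound (d : nat) (W : 'I_d -> T -> R) (K e : R) : (0 < e)%R ->
  (forall q, measurable_fun [set: T] (W q)) ->
  (forall q, W q \in Lfun P 2%:E) -> (forall q, 'V_P[W q] <= K%:E) ->
  P [set x | (e <= `|\sum_q W q x - \sum_q fine 'E_P[W q]|)%R] <=
  (e ^- 2 * (K * (d%:R + \sum_(q < d) \sum_(q' < d | q != q') `|corr P (W q) (W q')|)))%:E.
Proof.
move=> e0 mW W2 WK.
have mS : measurable_fun [set: T] (\sum_q W q)%R.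
  by rewrite fct_sumE; exact: measurable_sum.
pose S : {mfun T >-> R} := HB.pack (\sum_q W q)%R (isMeasurableFun.Build _ _ _ _ _ mS).
have := @chebyshev _ _ _ P S _ e0.
have -> : fine 'E_P[S] = (\sum_q fine 'E_P[W q])%R.
  exact: fine_expectation_sum.
have -> : [set x | (e <= `|S x - \sum_q fine 'E_P[W q]|)%R] =
    [set x | (e <= `|\sum_q W q x - \sum_q fine 'E_P[W q]|)%R].
  by apply/seteqP; split => x /=; rewrite /S /= fct_sumE.
move=> /le_trans; apply; rewrite EFinM lee_pmul2l //.
  exact: variance_sum_le.
by rewrite lte_fin invr_gt0 exprn_gt0.
Qed.

End WeakLaw.

Lemma measurable_component (R : realType) (d : nat) (q : 'I_d) :
  measurable_fun [set: d.-tuple R] (component q).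
Proof. exact: measurable_tnth. Qed.

Lemma sqdiff_componentE (R : realType) (d : nat) (q : 'I_d) :
  sqdiff_component q =
  (fun z : d.-tuple R * d.-tuple R => (component q z.1 - component q z.2) ^+ 2).
Proof. by apply/funext => z; rewrite /sqdiff_component /component tnth_mktuple. Qed.

Lemma measurable_set_ge (R : realType) d (T : measurableType d) (g : T -> R) (e : R) :
  measurable_fun [set: T] g -> measurable [set x | e <= g x].
Proof.
move=> mg; have -> : [set x | e <= g x] = [set: T] `&` g @^-1` `[e, +oo[.
  by apply/seteqP; split => x /=; rewrite in_itv /= andbT; [split|case].
exact: mg.
Qed.

Lemma enorm_ge0 (R : realType) (d : nat) (x : d.-tuple R) : 0 <= enorm x.
Proof. exact: sqrtr_ge0. Qed.

Lemma sqr_enorm (R : realType) (d : nat) (x : d.-tuple R) :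
  enorm x ^+ 2 = \sum_(q < d) tnth x q ^+ 2.
Proof. by rewrite /enorm sqr_sqrtr // sumr_ge0 // => q _; exact: sqr_ge0. Qed.

Lemma measurable_enorm_vsub (R : realType) (d : nat) :
  measurable_fun [set: d.-tuple R * d.-tuple R] (fun z => enorm (vsub z.1 z.2)).
Proof.
have mS : measurable_fun [set: d.-tuple R * d.-tuple R]
    (fun z => \sum_(q < d) sqdiff_component q z).
  apply: measurable_sum => q; rewrite sqdiff_componentE; apply: measurable_funX.
  by apply: measurable_sub_prod; exact: measurable_component.
apply: (@measurableT_comp _ _ _ _ _ _ (@Num.sqrt R)) mS.
by apply: continuous_measurable_fun; exact: sqrt_continuous.
Qed.

(** The mean squared distance between independent draws from [F d] and [G d], when second moments
    are finite. *)
Definition mean_sqdist (R : realType) (F G : forall d, probability (d.-tuple R) R) (d : nat) : R :=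
  \tr (covariance_matrix F d) + \tr (covariance_matrix G d) +
  enorm (vsub (mean_vector F d) (mean_vector G d)) ^+ 2.

(** The squared distance is a sum of squared coordinate differences. The variance of each is at most
    its second moment, that is a fourth moment bounded by [16 C], so Chebyshev's inequality
    applies. *)
Lemma sqdist_deviation (R : realType) (F G : forall d, probability (d.-tuple R) R) (C : R)
    (d : nat) (e : R) : 0 < e ->
  bounded_fourth_moments F C -> bounded_fourth_moments G C ->
  ((F d \x G d) [set z | (e <= `|enorm (vsub z.1 z.2) ^+ 2 - mean_sqdist F G d|)%R] <=
  (e ^- 2 * (16 * C * (d%:R + \sum_(q < d) \sum_(q' < d | q != q')
     `|corr (F d \x G d) (sqdiff_component q) (sqdiff_component q')|)))%:E)%E.
Proof.
move=> e0 FC GC.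
have mc := @measurable_component R d.
have mW q : measurable_fun [set: d.-tuple R * d.-tuple R] (sqdiff_component q).
  by rewrite sqdiff_componentE; apply: measurable_funX; exact: measurable_sub_prod.
have W4 q : ('E_(F d \x G d)[fun z => (sqdiff_component q z ^+ 2)%R] <= (16 * C)%:E)%E.
  have := expectation_quartic_diff (mc q) (mc q) (FC d q) (GC d q).
  by rewrite sqdiff_componentE; under [X in expectation _ X]eq_fun do rewrite (exprM _ 2 2).
have W2 q : sqdiff_component q \in Lfun (F d \x G d)%E 2%:E.
  apply: sqr_Lfun2 => //; apply: ge0_Lfun1; first exact: measurable_funM.
    by move=> z; exact: sqr_ge0.
  by rewrite (le_lt_trans (W4 q)) // ltry.
have WV q : ('V_(F d \x G d)[sqdiff_component q] <= (16 * C)%:E)%E.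
  rewrite varianceE // (le_trans _ (W4 q)) //.
  by rewrite leeBlDr ?leeDl ?expe2 ?sqre_ge0 // fin_numM ?expectation_fin_num // Lfun21.
have EW q : fine 'E_(F d \x G d)%E[sqdiff_component q] =
    covariance_matrix F d q q + covariance_matrix G d q q +
    tnth (vsub (mean_vector F d) (mean_vector G d)) q ^+ 2.
  rewrite sqdiff_componentE expectation_sqr_diff //.
  - by rewrite !mxE !tnth_mktuple.
  - by have [] := fourth_moment_Lfun (mc q) (FC d q).
  - by have [] := fourth_moment_Lfun (mc q) (GC d q).
have := weak_law_bound e0 mW W2 WV.
rewrite (eq_bigr _ (fun q _ => EW q)) !big_split /= -sqr_enorm.
have SE (z : d.-tuple R * d.-tuple R) :
  \sum_(q < d) sqdiff_component q z = enorm (vsub z.1 z.2) ^+ 2 by rewrite sqr_enorm.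
by under eq_set do rewrite SE.
Qed.

(** Chebyshev's inequality at threshold [d e^2 / 2] gives the bound [K (1 / d + Sc / d^2)], where
    [Sc] sums the absolute correlations; both terms tend to 0, the second by weak correlation. *)
Lemma dist_concentration (R : realType) (F G : forall d, probability (d.-tuple R) R)
    (C L : R) : 0 < C -> 0 <= L ->
  bounded_fourth_moments F C -> bounded_fourth_moments G C ->
  weakly_correlated F G -> (fun d => d%:R^-1 * mean_sqdist F G d) @ \oo --> L ->
  forall e eta : R, 0 < e -> 0 < eta -> \forall d \near \oo,
    ((F d \x G d) [set z | (e <= `|(Num.sqrt d%:R)^-1 * enorm (vsub z.1 z.2) -
      Num.sqrt L|)%R] <= eta%:E)%E.
Proof.
move=> C0 L0 FC GC FG FGL e eta e0 eta0.
have K0 : 0 < (e ^+ 2 / 2) ^- 2 * (16 * C).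
  by rewrite mulr_gt0 ?invr_gt0 ?exprn_gt0 ?divr_gt0 ?mulr_gt0 ?exprn_gt0.
set K := _ * (16 * C) in K0.
(* Chosen so that [K (del + del) = eta]: one [del] for [1 / d], the other for the correlations. *)
pose del := eta / (2 * K).
have del0 : 0 < del by rewrite divr_gt0 // mulr_gt0.
have e20 : 0 < e ^+ 2 / 2 by rewrite divr_gt0 // exprn_gt0.
near=> d.
have d0 : 0 < d%:R :> R by rewrite ltr0n; near: d; exact: nbhs_infty_gt.
have dinv : d%:R^-1 <= del :> R.
  rewrite -[del]invrK lef_pV2 ?posrE ?invr_gt0 //.
  by near: d; exact: nbhs_infty_ger.
have dL : `|L - d%:R^-1 * mean_sqdist F G d| < e ^+ 2 / 2.
  by near: d; apply: cvgr_dist_lt.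
have dcorr : `|\sum_(q < d) \sum_(q' < d | q != q')
     `|corr (F d \x G d)%E (sqdiff_component q) (sqdiff_component q')| | <=
    del * `|d%:R ^+ 2 : R|.
  by near: d; move/eqoP : FG; apply.
set Sc := \sum_(q < d) _ in dcorr.
have e' : 0 < d%:R * (e ^+ 2 / 2) by rewrite mulr_gt0.
have h := sqdist_deviation d e' FC GC; rewrite -/Sc in h.
apply: le_trans (le_trans _ h) _.
- apply: le_measure; rewrite ?inE.
  + apply: measurable_set_ge; apply: measurableT_comp => //; apply: measurable_funB => //.
    by apply: measurable_funM => //; exact: measurable_enorm_vsub.
  + apply: measurable_set_ge; apply: measurableT_comp => //; apply: measurable_funB => //.
    by apply: measurable_funX; exact: measurable_enorm_vsub.
  move=> z /= ez.
  set N := enorm _ in ez *.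
  have sd : Num.sqrt (d%:R : R) != 0 by rewrite gt_eqF // sqrtr_gt0.
  have N0 : 0 <= (Num.sqrt d%:R)^-1 * N by rewrite mulr_ge0 ?invr_ge0 ?sqrtr_ge0 ?enorm_ge0.
  have sL := sqrtr_ge0 L.
  (* For [y >= 0], the inequality [y + sqrt L >= |y - sqrt L|] turns a deviation [e] from [sqrt L]
     into a deviation [e^2] of [y^2] from [L], even when [L = 0]. *)
  have xL : e ^+ 2 <= `|((Num.sqrt d%:R)^-1 * N) ^+ 2 - L|.
    have -> : ((Num.sqrt d%:R)^-1 * N) ^+ 2 - L = ((Num.sqrt d%:R)^-1 * N - Num.sqrt L) *
        ((Num.sqrt d%:R)^-1 * N + Num.sqrt L) by rewrite -subr_sqr sqr_sqrtr.
    rewrite normrM expr2 ler_pM ?(ltW e0) //.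
    rewrite (le_trans ez) // [leRHS]ger0_norm ?addr_ge0 //.
    by rewrite (le_trans (ler_normB _ _)) // !ger0_norm.
  rewrite exprMn exprVn sqr_sqrtr ?(ltW d0) // in xL.
  (* The other half of [e^2] absorbs the distance between the normalised mean and [L]. *)
  have hN : e ^+ 2 / 2 <= `|d%:R^-1 * N ^+ 2 - d%:R^-1 * mean_sqdist F G d|.
    have := ler_normD (d%:R^-1 * N ^+ 2 - d%:R^-1 * mean_sqdist F G d)
      (d%:R^-1 * mean_sqdist F G d - L).
    rewrite addrA subrK [X in _ <= _ + X]distrC; lra.
  by move: hN; rewrite -mulrBr normrM gtr0_norm ?invr_gt0 // ler_pdivlMl.
- rewrite lee_fin.
  have Sc0 : 0 <= Sc by apply: sumr_ge0 => q _; apply: sumr_ge0.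
  rewrite !ger0_norm ?exprn_ge0 ?(ltW d0) // in dcorr.
  have -> : (d%:R * (e ^+ 2 / 2)) ^- 2 * (16 * C * (d%:R + Sc)) =
      K * (d%:R^-1 + Sc / d%:R ^+ 2).
    rewrite /K; field; rewrite gt_eqF //= gt_eqF //.
  have -> : eta = K * (del + del) by rewrite /del; field; rewrite gt_eqF.
  rewrite ler_pM2l // lerD // ler_pdivrMr ?exprn_gt0 //.
Unshelve. all: by end_near. Qed.

(** The product law is determined by its values on rectangles, where the identity is independence of
    the pair [i], [j]. *)
Lemma joint_law (R : realType) (dO dV : measure_display) (Omega : measurableType dO)
    (V : measurableType dV) (P : probability Omega R) (I : finType) (X : I -> {RV P >-> V})
    (i j : I) (F G : probability V R) : mutually_independent X -> i != j ->
  (forall B, measurable B -> distribution P (X i) B = F B) ->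
  (forall B, measurable B -> distribution P (X j) B = G B) ->
  forall A, measurable A -> P [set w | A (X i w, X j w)] = (F \x G)%E A.
Proof.
move=> indep ij XF XG A mA.
have mf : measurable_fun [set: Omega] (fun w => (X i w, X j w)).
  by apply: measurable_fun_pair.
pose f : {mfun Omega >-> (V * V)%type} :=
  HB.pack (fun w => (X i w, X j w)) (isMeasurableFun.Build _ _ _ _ _ mf).
have := @product_measure_unique _ _ _ _ _ F G (distribution P f).
move=> -> // B1 B2 mB1 mB2.
have := indep [set i; j]%SET (fun k => if k == i then B1 else B2).
rewrite big_setU1 ?inE //= big_set1 eqxx eq_sym (negPf ij).
rewrite -XF // -XG // => <-; last by move=> k; case: ifP.
congr (P _); apply/seteqP; split => w /=.
  by move=> [? ?] k; rewrite /= !inE => /orP[] /eqP ->; rewrite ?eqxx // eq_sym (negPf ij).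
move=> h; split; first by have := h i; rewrite /= !inE eqxx /=; apply.
by have := h j; rewrite /= !inE eqxx orbT [j == i]eq_sym (negPf ij) /=; apply.
Qed.

(** * Measurability and convergence of the detection events *)

Lemma measure_bigsetU_le (R : realType) dO (T : measurableType dO) (P : probability T R)
    (I : Type) (r : seq I) (Q : pred I) (B : I -> set T) : (forall i, measurable (B i)) ->
  (P (\big[setU/set0]_(i <- r | Q i) B i) <= \sum_(i <- r | Q i) P (B i))%E.
Proof.
move=> mB; elim: r => [|i r IH]; first by rewrite !big_nil measure0.
rewrite !big_cons; case: ifP => // Qi.
apply: le_trans (measureU2 _ _ _) _ => //; last exact: leeD2l.
by apply: bigsetU_measurable => j _.
Qed.

Lemma cvg_probability1 (R : realType) (disp : nat -> measure_display)
    (Omega : forall d : nat, measurableType (disp d))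
    (P : forall d : nat, probability (Omega d) R) (G : forall d, set (Omega d)) :
  (forall d, measurable (G d)) ->
  (forall eta : R, 0 < eta -> \forall d \near \oo, (P d (~` G d) <= eta%:E)%E) ->
  (fun d => P d (G d)) @ \oo --> (1 : \bar R)%E.
Proof.
move=> mG PG; apply/fine_cvgP; split.
  by apply: nearW => d; apply: fin_num_measure.
apply/cvgrPdist_le => /= eta eta0; near=> d.
have := near (PG _ eta0) d; rewrite probability_setC // => /(_ _) h.
have Pf : P d (G d) \is a fin_num by apply: fin_num_measure.
have : (1 - (fine (P d (G d)))%:E <= eta%:E)%E by rewrite fineK //; apply: h.
have : (fine (P d (G d)) <= 1)%R by rewrite -lee_fin fineK // probability_le1.
rewrite -EFinB lee_fin => h1 h2.
by rewrite ger0_norm ?subr_ge0.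
Unshelve. all: by end_near. Qed.

Lemma measurable_sum_cond (R : realType) dO (T : measurableType dO) (I : Type) (r : seq I)
    (Q : pred I) (f : I -> T -> R) : (forall i, measurable_fun [set: T] (f i)) ->
  measurable_fun [set: T] (fun w => \sum_(i <- r | Q i) f i w).
Proof. by move=> mf; under eq_fun do rewrite -big_filter; exact: measurable_sum. Qed.

Lemma measurable_bigmax (R : realType) dO (T : measurableType dO) (I : Type) (r : seq I)
    (f : I -> T -> R) : (forall i, measurable_fun [set: T] (f i)) ->
  measurable_fun [set: T] (fun w => \big[Num.max/0]_(i <- r) f i w).
Proof.
move=> mf; elim: r => [|i r IH].
  by under eq_fun do rewrite big_nil; exact: measurable_cst.
by under eq_fun do rewrite big_cons; exact: measurable_maxr.
Qed.

Lemma measurable_Shat (R : realType) dO (T : measurableType dO) n d m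
    (Z : 'I_n -> T -> d.-tuple R) : (forall i, measurable_fun [set: T] (Z i)) ->
  measurable_fun [set: T] (fun w => Shat m (fun i => Z i w)).
Proof.
move=> mZ; apply: measurable_bigmax => t.
have mD i j : measurable_fun [set: T] (fun w => enorm (vsub (Z i w) (Z j w))).
  exact: (measurableT_comp (@measurable_enorm_vsub R d) (measurable_fun_pair (mZ i) (mZ j))).
rewrite /scan /Dstat /T12 /T11 /T22; apply: measurable_funM => //.
by apply: measurable_funD; apply: measurable_funX; apply: measurable_funB;
  apply: measurable_funM => //; do 2 (apply: measurable_sum_cond => ?).
Qed.

(** The counting form in [chat_lt_Shat] involves only finitely many measurable statistics, so the
    infimum disappears from the event. *)
Lemma measurable_chat_lt_Shat (R : realType) dO (T : measurableType dO) n d m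
    (Z : 'I_n -> T -> d.-tuple R) (alpha : R) : 0 < alpha ->
  (forall i, measurable_fun [set: T] (Z i)) ->
  measurable [set w | chat m (fun i => Z i w) alpha < Shat m (fun i => Z i w)].
Proof.
move=> a0 mZ.
have mS := measurable_Shat m mZ.
have -> : [set w | chat m (fun i => Z i w) alpha < Shat m (fun i => Z i w)] =
    ~` [set w | 0 <= - Shat m (fun i => Z i w)] `&`
    [set w | 1 - alpha <= (n`!)%:R^-1 * \sum_(s : 'S_n)
      (if Shat m (fun i => Z (s i) w) < Shat m (fun i => Z i w) then 1 else 0)].
  apply/seteqP; split => w /=; rewrite chat_lt_Shat // oppr_ge0 => -[S0 h]; split.
  - by apply/negP; rewrite -ltNge.
  - by apply: le_trans h _; rewrite ler_pM2l ?invr_gt0 ?ltr0n ?fact_gt0 //;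
      apply: ler_sum => s _; case: (_ < _).
  - by rewrite ltNge; apply/negP.
  - by apply: le_trans h _; rewrite ler_pM2l ?invr_gt0 ?ltr0n ?fact_gt0 //;
      apply: ler_sum => s _; case: (_ < _).
apply: measurableI.
  by apply: measurableC; apply: measurable_set_ge; exact: measurable_funN.
apply: measurable_set_ge; apply: measurable_funM => //.
apply: measurable_sum => s; apply: measurable_fun_ifT => //.
apply: measurable_fun_ltr => //.
by apply: (@measurable_Shat _ _ _ _ _ _ (fun i => Z (s i))).
Qed.

(** * Consequences of separated distances for the argmax and the test *)

Lemma enorm_vsubC (R : realType) d (x y : d.-tuple R) : enorm (vsub x y) = enorm (vsub y x).
Proof.
by rewrite /enorm; congr Num.sqrt; apply: eq_bigr => q _; rewrite !tnth_mktuple -sqrrN opprB.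
Qed.

Lemma enorm_vsub0 (R : realType) d (x : d.-tuple R) : enorm (vsub x x) = 0.
Proof.
rewrite /enorm big1 ?sqrtr0 // => q _; by rewrite tnth_mktuple subrr expr0n.
Qed.

(** One has [(a + b)^2 <= 2 (a^2 + b^2) = 4 (sigma1^2 + sigma2^2) <= 4 c^2]; equality throughout
    would force [nu = 0] and [a = b], hence [sigma1^2 = sigma2^2]. *)
Lemma cross_distance_gt (R : realType) (nu sigma1 sigma2 : R) :
  0 < nu ^+ 2 \/ sigma1 ^+ 2 != sigma2 ^+ 2 ->
  Num.sqrt (sigma1 ^+ 2 + sigma1 ^+ 2) + Num.sqrt (sigma2 ^+ 2 + sigma2 ^+ 2) <
  2 * Num.sqrt (sigma1 ^+ 2 + sigma2 ^+ 2 + nu ^+ 2).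
Proof.
move=> sep; have s1 := sqr_ge0 sigma1; have s2 := sqr_ge0 sigma2; have n0 := sqr_ge0 nu.
set a := Num.sqrt (_ + _); set b := Num.sqrt (_ + _); set c := Num.sqrt _.
have a2 : a ^+ 2 = sigma1 ^+ 2 + sigma1 ^+ 2 by rewrite sqr_sqrtr // addr_ge0.
have b2 : b ^+ 2 = sigma2 ^+ 2 + sigma2 ^+ 2 by rewrite sqr_sqrtr // addr_ge0.
have c2 : c ^+ 2 = sigma1 ^+ 2 + sigma2 ^+ 2 + nu ^+ 2 by rewrite sqr_sqrtr // !addr_ge0.
have c0 : 0 <= c by exact: sqrtr_ge0.
rewrite ltNge; apply/negP => cab.
have cab2 : (2 * c) ^+ 2 <= (a + b) ^+ 2.
  by rewrite ler_sqr ?nnegrE ?addr_ge0 ?sqrtr_ge0 // mulr_ge0.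
have ab0 := sqr_ge0 (a - b).
case: sep => [nu0|/eqP ss]; first nra.
have ab : (a - b) ^+ 2 = 0 by apply/eqP; rewrite eq_le ab0 andbT; nra.
apply: ss; move/eqP: ab; rewrite sqrf_eq0 subr_eq0 => /eqP ab.
by move: a2; rewrite ab; lra.
Qed.

Lemma separated_scan (R : realType) (n d m tau : nat) (k : R)
    (z : 'I_n -> d.-tuple R) :
  change_separated m tau (fun i j => k * enorm (vsub (z i) (z j))) ->
  [/\ 0 < scan z tau,
  forall t, t \in Aset n m -> t != tau -> scan z t < scan z tau &
  forall (s : 'S_n) t, s \notin unbalanced n m tau (rho R n m tau) -> t \in Aset n m ->
    scan (fun i => z (s i)) t < scan z tau].
Proof.
move=> sep; have scanE (z' : 'I_n -> d.-tuple R) t :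
    weight R n t * split_gap (fun i j => k * enorm (vsub (z' i) (z' j))) t = k ^+ 2 * scan z' t.
  by rewrite split_gapZ /scan Dstat_split_gap mulrCA.
have lt_sq x y : k ^+ 2 * x < k ^+ 2 * y -> x < y.
  by rewrite !ltNge; apply: contra => xy; rewrite ler_wpM2l ?sqr_ge0.
have [h1 h2 h3] := sep; rewrite scanE in h1; split.
- by apply: lt_sq; rewrite mulr0.
- by move=> t tA ttau; apply: lt_sq; rewrite -!scanE; exact: h2.
- move=> s t sB tA; apply: lt_sq; rewrite -!scanE.
  exact: (h3 s t sB tA).
Qed.

Lemma separated_argmax (R : realType) (n d m tau : nat) (k : R)
    (z : 'I_n -> d.-tuple R) t :
  tau \in Aset n m ->
  change_separated m tau (fun i j => k * enorm (vsub (z i) (z j))) ->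
  is_argmax m z t -> t = tau.
Proof.
move=> tauA sep [tA tmax]; apply/eqP/negPn/negP => ttau.
have [_ h _] := separated_scan sep.
by have := tmax tau tauA; rewrite leNgt h.
Qed.

(** Every permutation outside the unbalanced set has a strictly smaller statistic, so at least a
    proportion [1 - alpha] of all permutations falls below [Shat]; this is the criterion of
    [chat_lt_Shat]. *)
Lemma separated_detected (R : realType) (n d m tau : nat) (k : R)
    (z : 'I_n -> d.-tuple R) alpha :
  tau \in Aset n m ->
  change_separated m tau (fun i j => k * enorm (vsub (z i) (z j))) ->
  0 < alpha ->
  #|unbalanced n m tau (rho R n m tau)|%:R / (n`!)%:R <= alpha ->
  chat m z alpha < Shat m z.
Proof.
move=> tauA sep a0; set B := unbalanced _ _ _ _ => Ba.
have [S0 _ h] := separated_scan sep.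
have Sz : scan z tau <= Shat m z by exact: le_bigmax_Aset.
apply/chat_lt_Shat => //; split; first exact: lt_le_trans Sz.
have F0 : 0 < (n`!)%:R :> R by rewrite ltr0n fact_gt0.
apply: le_trans (_ : (n`!)%:R^-1 * (\sum_(s : 'S_n) (s \notin B)%:R) <= _).
  have -> : \sum_(s : 'S_n) ((s \notin B)%:R : R) = (n`!)%:R - #|B|%:R.
    rewrite -sum1_card natr_sum -(card_Sn n) -sum1_card natr_sum [X in _ = _ - X]big_mkcond /=.
    rewrite [X in _ = X - _](eq_bigl xpredT); last by move=> s; rewrite inE.
    by rewrite -sumrB; apply: eq_bigr => s _; case: (s \in B); rewrite /= ?subrr ?subr0.
  rewrite mulrBr mulVf ?gt_eqF //; move: Ba; rewrite mulrC; lra.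
rewrite ler_pM2l ?invr_gt0 //; apply: ler_sum => s _.
have [//|sB] := boolP (s \in B).
rewrite (_ : _ < _ = true) //; apply: bigmax_Aset_lt; first exact: lt_le_trans Sz.
by move=> t tA; apply: lt_le_trans Sz; exact: h.
Qed.

Lemma cvg_mean_sqdist (R : realType) (F G : forall d, probability (d.-tuple R) R) (f g r : R) :
  (fun d : nat => d%:R^-1 * \tr (covariance_matrix F d)) @ \oo --> f ->
  (fun d : nat => d%:R^-1 * \tr (covariance_matrix G d)) @ \oo --> g ->
  (fun d : nat => d%:R^-1 * enorm (vsub (mean_vector F d) (mean_vector G d)) ^+ 2)
    @ \oo --> r ->
  (fun d : nat => d%:R^-1 * mean_sqdist F G d) @ \oo --> f + g + r.
Proof.
move=> hf hg hr; rewrite /mean_sqdist; under eq_fun do rewrite !mulrDr.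
exact: (cvgD (cvgD hf hg) hr).
Qed.

Lemma bounded_fourth_moments_le (R : realType) (F : forall d, probability (d.-tuple R) R)
    (C C' : R) : C <= C' -> bounded_fourth_moments F C -> bounded_fourth_moments F C'.
Proof. by move=> CC' FC d q; rewrite (le_trans (FC d q)) // lee_fin. Qed.

Theorem theorem2 (R : realType) (n tau : nat) (delta : R)
  (delta_range : 0 < delta < 1 / 2)
  (window_ge2 : (2 <= window n delta)%N)
  (tau_in : tau \in Aset n (window n delta))
  (F1 F2 : forall d : nat, probability (d.-tuple R) R)
  (disp : nat -> measure_display)
  (Omega : forall d : nat, measurableType (disp d))
  (P : forall d : nat, probability (Omega d) R)
  (Z : forall d : nat, 'I_n -> {RV (P d) >-> (d.-tuple R)})
  (Z_indep : forall d : nat, mutually_independent (Z d))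
  (Z_law1 : forall (d : nat) (i : 'I_n), (i < tau)%N ->
     forall B : set (d.-tuple R), measurable B ->
       distribution (P d) (Z d i) B = F1 d B)
  (Z_law2 : forall (d : nat) (i : 'I_n), (tau <= i)%N ->
     forall B : set (d.-tuple R), measurable B ->
       distribution (P d) (Z d i) B = F2 d B)
  (A1 : exists C : R,
     bounded_fourth_moments F1 C /\ bounded_fourth_moments F2 C)
  (A2 : [/\ weakly_correlated F1 F1, weakly_correlated F1 F2,
            weakly_correlated F2 F1 & weakly_correlated F2 F2])
  (nu sigma1 sigma2 : R)
  (A3_mean : (fun d : nat =>
       d%:R^-1 * enorm (vsub (mean_vector F1 d) (mean_vector F2 d)) ^+ 2)
       @ \oo --> nu ^+ 2)
  (A3_cov1 : (fun d : nat => d%:R^-1 * \tr (covariance_matrix F1 d))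
       @ \oo --> sigma1 ^+ 2)
  (A3_cov2 : (fun d : nat => d%:R^-1 * \tr (covariance_matrix F2 d))
       @ \oo --> sigma2 ^+ 2)
  (separation : 0 < nu ^+ 2 \/ sigma1 ^+ 2 != sigma2 ^+ 2)
  (That : forall d : nat, {RV (P d) >-> nat})
  (That_argmax : forall (d : nat) (w : Omega d),
     is_argmax (window n delta) (fun i => Z d i w) (That d w)) :
  ((fun d : nat => P d [set w | That d w = tau]) @ \oo --> (1 : \bar R)%E)
  /\
  (forall alpha : R, 0 < alpha < 1 ->
     #|unbalanced n (window n delta) tau (rho R n (window n delta) tau)|%:R
       / (n`!)%:R <= alpha ->
     (fun d : nat => P d [set w | That d w = tau /\
        chat (window n delta) (fun i => Z d i w) alpha
          < Shat (window n delta) (fun i => Z d i w)])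
       @ \oo --> (1 : \bar R)%E).
Proof.
move: window_ge2 tau_in That_argmax; set m := window n delta => m2 tauA That_argmax.
have [C0 [FC1 FC2]] := A1; have [W11 W12 W21 W22] := A2.
(* The sign of [C0] is unknown, while the concentration bound asks for a positive constant. *)
pose C := `|C0| + 1.
have Cgt0 : 0 < C by rewrite ltr_wpDl.
have CC : C0 <= C by rewrite (le_trans (ler_norm C0)) // lerDl.
have FC1' := bounded_fourth_moments_le CC FC1.
have FC2' := bounded_fourth_moments_le CC FC2.
pose a := Num.sqrt (sigma1 ^+ 2 + sigma1 ^+ 2).
pose b := Num.sqrt (sigma2 ^+ 2 + sigma2 ^+ 2).
pose c := Num.sqrt (sigma1 ^+ 2 + sigma2 ^+ 2 + nu ^+ 2).
have abc : a + b < 2 * c := cross_distance_gt separation.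
have [e e0 eP] := near_change_separated m2 tauA abc.
pose bad d (i j : 'I_n) (w : Omega d) :=
  e <= `|(Num.sqrt d%:R)^-1 * enorm (vsub (Z d i w) (Z d j w)) - block_dist tau a b c i j|.
(* Inside one group the mean difference vanishes, so the limit 0 takes the place of [nu ^+ 2]. *)
have same (F : forall d, probability (d.-tuple R) R) :
    (fun d : nat => d%:R^-1 * enorm (vsub (mean_vector F d) (mean_vector F d)) ^+ 2)
      @ \oo --> (0 : R).
  by under eq_fun do rewrite enorm_vsub0 expr0n mulr0; exact: cvg_cst.
have A3_mean' : (fun d : nat =>
    d%:R^-1 * enorm (vsub (mean_vector F2 d) (mean_vector F1 d)) ^+ 2) @ \oo --> nu ^+ 2.
  by under eq_fun do rewrite enorm_vsubC.
have badP (i j : 'I_n) : i != j -> forall eta : R, 0 < eta ->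
    \forall d \near \oo, (P d [set w | bad d i j w] <= eta%:E)%E.
  move=> ij eta eta0.
  (* Common to the four cases of group membership of [i] and [j]; [r] is [nu] across the groups and
     0 inside a group. *)
  have key (F G : forall d, probability (d.-tuple R) R) (f g r : R) :
      bounded_fourth_moments F C -> bounded_fourth_moments G C -> weakly_correlated F G ->
      (fun d : nat => d%:R^-1 * \tr (covariance_matrix F d)) @ \oo --> f ^+ 2 ->
      (fun d : nat => d%:R^-1 * \tr (covariance_matrix G d)) @ \oo --> g ^+ 2 ->
      (fun d : nat => d%:R^-1 * enorm (vsub (mean_vector F d) (mean_vector G d)) ^+ 2)
        @ \oo --> r ^+ 2 ->
      (forall d B, measurable B -> distribution (P d) (Z d i) B = F d B) ->
      (forall d B, measurable B -> distribution (P d) (Z d j) B = G d B) ->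
      block_dist tau a b c i j = Num.sqrt (f ^+ 2 + g ^+ 2 + r ^+ 2) ->
      \forall d \near \oo, (P d [set w | bad d i j w] <= eta%:E)%E.
    move=> FC GC FG Ff Gg FGr ZF ZG ijE.
    have L0 : 0 <= f ^+ 2 + g ^+ 2 + r ^+ 2 by rewrite !addr_ge0 ?sqr_ge0.
    have := dist_concentration Cgt0 L0 FC GC FG (cvg_mean_sqdist Ff Gg FGr) e0 eta0.
    apply: filterS => d; rewrite /bad ijE; set A := [set z | _].
    rewrite -(joint_law (Z_indep d) ij (ZF d) (ZG d)) //.
    apply: measurable_set_ge; apply: measurableT_comp => //; apply: measurable_funB => //.
    by apply: measurable_funM => //; exact: measurable_enorm_vsub.
  have z0 : (0 : R) = 0 ^+ 2 by rewrite expr0n.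
  have [it|it] := ltnP i tau; have [jt|jt] := ltnP j tau.
  - apply: (@key F1 F1 sigma1 sigma1 0) => //.
    + by rewrite -z0.
    + by move=> d; exact: Z_law1.
    + by move=> d; exact: Z_law1.
    + by rewrite /block_dist (negPf ij) it jt -z0 addr0.
  - apply: (@key F1 F2 sigma1 sigma2 nu) => //.
    + by move=> d; exact: Z_law1.
    + by move=> d; exact: Z_law2.
    + by rewrite /block_dist (negPf ij) it ltnNge jt.
  - apply: (@key F2 F1 sigma2 sigma1 nu) => //.
    + by move=> d; exact: Z_law2.
    + by move=> d; exact: Z_law1.
    + by rewrite /block_dist (negPf ij) (ltnNge i) it jt /= /c (addrC (sigma1 ^+ 2)).
  - apply: (@key F2 F2 sigma2 sigma2 0) => //.
    + by rewrite -z0.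
    + by move=> d; exact: Z_law2.
    + by move=> d; exact: Z_law2.
    + by rewrite /block_dist (negPf ij) !ltnNge it jt /= -z0 addr0.
(* Outside this finite union all off-diagonal distances are within [e] of their limits. *)
pose bads d := \big[setU/set0]_(p : 'I_n * 'I_n | p.1 != p.2) [set w | bad d p.1 p.2 w].
have mbad d i j : measurable [set w | bad d i j w].
  apply: measurable_set_ge; apply: measurableT_comp => //; apply: measurable_funB => //.
  apply: measurable_funM => //.
  by apply: (measurableT_comp (@measurable_enorm_vsub R d) (measurable_fun_pair _ _)).
have badsP (eta : R) : 0 < eta -> \forall d \near \oo, (P d (bads d) <= eta%:E)%E.
  move=> eta0.
  pose N := #|[pred p : 'I_n * 'I_n | p.1 != p.2]|.
  (* The [N] events share [eta]; the divisor [N + 1] is positive in all cases. *)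
  have eta'0 : 0 < eta / N.+1%:R by rewrite divr_gt0.
  have : \forall d \near \oo, forall p : 'I_n * 'I_n, p.1 != p.2 ->
      (P d [set w | bad d p.1 p.2 w] <= (eta / N.+1%:R)%:E)%E.
    apply: filter_forall => p; have [pp|pp] := eqVneq p.1 p.2; first exact: filterE.
    by apply: filterS (badP _ _ pp _ eta'0) => d.
  apply: filterS => d h.
  apply: le_trans (measure_bigsetU_le _ _ _ _) _; first by move=> p; exact: mbad.
  apply: le_trans (lee_sum _ h) _; rewrite sumEFin lee_fin sumr_const -/N.
  by rewrite -[_ *+ N]mulr_natr -mulrA ler_piMr ?(ltW eta0) // mulrC ler_pdivrMr // mul1r ler_nat.
have good d w : ~ bads d w ->
    change_separated m tau (fun i j => (Num.sqrt d%:R)^-1 * enorm (vsub (Z d i w) (Z d j w))).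
  move=> nbad; apply: eP => [i|i j ij]; first by rewrite enorm_vsub0 mulr0.
  rewrite ltNge; apply/negP => bij; apply: nbad.
  by rewrite /bads (bigD1 (i, j)) //=; left.
have finish (G : forall d, set (Omega d)) : (forall d, measurable (G d)) ->
    (forall d w, ~ bads d w -> G d w) -> (fun d => P d (G d)) @ \oo --> (1 : \bar R)%E.
  move=> mG bG; apply: cvg_probability1 => // eta eta0.
  apply: filterS (badsP _ eta0) => d; apply: le_trans.
  apply: le_measure; rewrite ?inE; first exact: measurableC.
    by apply: bigsetU_measurable => p _; exact: mbad.
  by move=> w nG; apply: contrapT => /bG.
have mThat d : measurable [set w | That d w = tau].
  by rewrite -[X in measurable X]setTI; exact: (measurable_funPT (That d) measurableT [set tau]).
split=> [|alpha /andP[a0 _] Ba]; apply: finish => [d|d w nb].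
- exact: mThat.
- exact: (separated_argmax tauA (good d w nb) (That_argmax d w)).
- apply: measurableI; first exact: mThat.
  exact: measurable_chat_lt_Shat.
- split; first exact: (separated_argmax tauA (good d w nb) (That_argmax d w)).
  exact: (separated_detected tauA (good d w nb) a0 Ba).
Qed.
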